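(* Let $A$ be analytic in $\mathbb{D}$. For $0<r<1$ and $z\in\mathbb{D}$ let $$A_{r,z}(u)=\overline{\int_0^z\int_0^\zeta\frac{A(rw)}{1-\overline{u}w}\,dw\,d\zeta},\qquad u\in\mathbb{D}.$$ If $$\limsup_{r\to1^-}\ \sup_{z\in\mathbb{D}}\ \|A_{r,z}\|_{\mathcal{K}}<1,$$ then every analytic solution $f$ in $\mathbb{D}$ of $f''+Af=0$ is bounded in $\mathbb{D}$.
   Context: $\mathbb{D}$ is the open unit disc of $\mathbb{C}$ and $\mathbb{T}=\partial\mathbb{D}$. Let $M$ be the set of all finite complex Borel measures on $\mathbb{T}$, and let $\|\mu\|=|\mu|(\mathbb{T})$ be the total variation of $\mu\in M$. The space $\mathcal{K}$ of Cauchy transforms consists of the analytic functions in $\mathbb{D}$ of the form $(K\mu)(z)=\int_{\mathbb{T}}\frac{d\mu(\zeta)}{1-\overline{\zeta}z}$, $z\in\mathbb{D}$, for some $\mu\in M$, with norm $\|f\|_{\mathcal{K}}=\inf\{\|\mu\|:\mu\in M,\ f=K\mu\}$. *)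

(* Defs.v *)
From HB Require Import structures.
From mathcomp Require Import all_boot all_order all_algebra.
From mathcomp Require Import complex.
From mathcomp Require Import all_classical all_reals all_analysis.

Set Implicit Arguments.
Unset Strict Implicit.
Unset Printing Implicit Defensive.

Import Order.TTheory GRing.Theory Num.Theory.
Import numFieldNormedType.Exports.
Local Open Scope classical_set_scope.
Local Open Scope ring_scope.
Local Open Scope complex_scope.

(* The topology and normed space structure of C as a numFieldType over itself,
   so that derive1 of f : R[i] -> R[i] is the complex derivative. *)
#[export, non_forgetful_inheritance]
HB.instance Definition _ (R : realType) := GRing.ComAlgebra.copy R[i] R[i]^o.
#[export, non_forgetful_inheritance]
HB.instance Definition _ (R : realType) := Vector.copy R[i] R[i]^o.
#[export, non_forgetful_inheritance]
HB.instance Definition _ (R : realType) := NormedModule.copy R[i] R[i]^o.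

Definition unit_disc (R : realType) : set R[i] := [set z | `|z| < 1].

(* Complex analyticity as local power series expansion.  A function analytic in
   an open set is represented by a total function whose values outside the set
   are irrelevant. *)
Definition analytic_on (R : realType) (U : set R[i]) (f : R[i] -> R[i]) : Prop :=
  forall z0, U z0 -> exists (a : nat -> R[i]) (e : R), 0 < e /\
    forall z, `|z - z0| < e%:C ->
      series (fun n => a n * (z - z0) ^+ n) @ \oo --> f z.

Definition unit_circle (R : realType) : Type :=
  set_type [set z : R[i] | `|z| = 1].

HB.instance Definition _ (R : realType) := Choice.on (unit_circle R).

Definition circle_one (R : realType) : unit_circle R :=
  SigSub (mem_set (normr1 R[i]) : 1 \in [set z : R[i] | `|z| = 1]).

HB.instance Definition _ (R : realType) :=
  isPointed.Build (unit_circle R) (circle_one R).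

Definition circle_val (R : realType) (z : unit_circle R) : R[i] := \val z.

(* The Borel sigma-algebra of the circle is generated by the relatively open
   subsets. *)
Definition borel_circle (R : realType) :=
  g_sigma_algebraType
    [set (@circle_val R) @^-1` V | V in [set V : set R[i] | open V]].

(* A finite complex Borel measure, given by its real and imaginary parts, which
   are arbitrary finite signed measures. *)
Record complex_measure (R : realType) := ComplexMeasure {
  re_part : {charge set (borel_circle R) -> \bar R} ;
  im_part : {charge set (borel_circle R) -> \bar R} }.

Definition cmeasure (R : realType) (mu : complex_measure R)
    (E : set (borel_circle R)) : R[i] :=
  fine (re_part mu E) +i* fine (im_part mu E).

(* |mu|(T): supremum of sum_n |mu(E_n)| over countable measurable partitions of
   the circle (blocks may be empty, so finite partitions are included). *)
Definition cmeasure_variation (R : realType) (mu : complex_measure R) : \bar R :=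
  ereal_sup [set (\sum_(0 <= n <oo) (Normc.normc (cmeasure mu (F n)))%:E)%E |
    F in [set F : (set (borel_circle R))^nat |
      [/\ forall n, measurable (F n), trivIset setT F &
          \bigcup_n F n = setT]]].

Definition positive_hahn_set (R : realType)
    (nu : {charge set (borel_circle R) -> \bar R}) : set (borel_circle R) :=
  projT1 (cid (Hahn_decomposition nu)).

Definition negative_hahn_set (R : realType)
    (nu : {charge set (borel_circle R) -> \bar R}) : set (borel_circle R) :=
  projT1 (cid (projT2 (cid (Hahn_decomposition nu)))).

Definition hahn_sets (R : realType)
    (nu : {charge set (borel_circle R) -> \bar R}) :
  hahn_decomposition nu (positive_hahn_set nu) (negative_hahn_set nu) :=
  projT2 (cid (projT2 (cid (Hahn_decomposition nu)))).

(* The Jordan decomposition, hence the integral, does not depend on the chosen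
   Hahn decomposition. *)
Definition charge_integral (R : realType)
    (nu : {charge set (borel_circle R) -> \bar R})
    (g : borel_circle R -> R) : R :=
  (\int[jordan_pos (hahn_sets nu)]_u g u) -
  (\int[jordan_neg (hahn_sets nu)]_u g u).

Definition cmeasure_integral (R : realType) (mu : complex_measure R)
    (g : borel_circle R -> R[i]) : R[i] :=
  let g1 u := complex.Re (g u) in
  let g2 u := complex.Im (g u) in
  (charge_integral (re_part mu) g1 - charge_integral (im_part mu) g2) +i*
  (charge_integral (re_part mu) g2 + charge_integral (im_part mu) g1).

Definition cauchy_transform (R : realType) (mu : complex_measure R)
    (z : R[i]) : R[i] :=
  cmeasure_integral mu
    (fun zeta : borel_circle R => (1 - (circle_val zeta)^* * z)^-1).

(* The norm of the space of Cauchy transforms; it is +oo exactly when f is not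
   a Cauchy transform in the unit disc (infimum of the empty set). *)
Definition cauchy_norm (R : realType) (f : R[i] -> R[i]) : \bar R :=
  ereal_inf [set cmeasure_variation mu |
    mu in [set mu : complex_measure R |
      forall z, unit_disc z -> f z = cauchy_transform mu z]].

(* Integral of g along the straight segment from 0 to z. *)
Definition segment_integral (R : realType) (g : R[i] -> R[i]) (z : R[i]) : R[i] :=
  let h (t : R) := g (t%:C * z) * z in
  (\int[@lebesgue_measure R]_(t in `[0, 1]) complex.Re (h t)) +i*
  (\int[@lebesgue_measure R]_(t in `[0, 1]) complex.Im (h t)).

(* For u, z in the unit disc and 0 < r < 1 the integrands are analytic in the
   disc, so the integrals over paths from 0 may be taken along segments. *)
Definition A_kernel (R : realType) (A : R[i] -> R[i]) (r : R) (z u : R[i]) : R[i] :=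
  (segment_integral
     (segment_integral (fun w => A (r%:C * w) / (1 - u^* * w))) z)^*.

(* Main.v *)
Require Import Defs.
From mathcomp Require Import all_boot all_order all_algebra.
From mathcomp Require Import complex.
From mathcomp Require Import all_classical all_reals all_analysis.
From mathcomp Require Import measurable_realfun.
From mathcomp Require Import cyclic separable cyclotomic.
From mathcomp Require Import ring lra zify.
Import Order.TTheory GRing.Theory Num.Theory.
Import numFieldNormedType.Exports.
Set Implicit Arguments.
Unset Strict Implicit.
Unset Printing Implicit Defensive.
Local Open Scope classical_set_scope.
Local Open Scope ring_scope.
Local Open Scope complex_scope.

(** Write f = sum phi_m z^m and A = sum alpha_j z^j in the disc, fix 0 < r < 1 and
integrate f'' = - A f twice from 0 after the dilation z |-> r z.  With
f_r(z) = f(r z) this gives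
[f_r(z) = phi_0 + phi_1 r z - r^2 sum_m (phi_m r^m) beta_m(z)]
where beta_m(z) is the double integral from 0 to z of A(r w) w^m
(solution_formula).  Expanding the kernel 1 / (1 - conj(u) w) in powers of
conj(u) shows that the same numbers are the conjugated Taylor coefficients of
the function A_{r,z} of u (A_kernel_ps).  If A_{r,z} is the Cauchy transform of
mu, its m-th coefficient is also the moment of conj(zeta)^m under mu, so
conj(beta_m) is that moment by uniqueness of coefficients, and the sum in the
formula is, up to conjugation, the integral of conj(f_r) against mu.  It is
therefore at most ||mu|| times the maximum of |f_r| on the circle
(moment_pairing_series).  When ||A_{r,z}|| < v < 1 for all z, the supremum S of
|f_r| on the closed disc, which is finite because r < 1, satisfies
S <= |phi_0| + |phi_1| + v S, that is S <= (|phi_0| + |phi_1|) / (1 - v)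
(bound_at_radius).  This does not depend on r, and r -> 1 gives the theorem.

Working with coefficients replaces the Cauchy integral formula, boundary values
and Fubini by rearrangements of absolutely convergent double series, all of
which are instances of double_series.

What remains is to know that a function analytic in the disc, in the sense of
local expansions, is the sum of one power series there (analytic_power_series).
This is obtained without contour integrals.  Averaging a polynomial over roots
of unity gives the Cauchy estimate |a_n| s^n <= max |f| on |z| = s
(cauchy_estimate).  Suppose the series at 0 represents f on |z| < rho with
rho < 1.  By compactness the expansions of f at all points of |z| <= rho have
k-th coefficients bounded by n n^k for a single n.  For |z| < rho the k-th
coefficient is f^(k)(z) / k!, itself a power series in z, and the Cauchy
estimate bounds its coefficients; summing over k bounds a_m (s + 1/(2n))^m for
every s < rho (pconv_of_dcoef_bounded), so the radius of convergence exceeds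
rho (extend_expansion). *)

(** * The modulus, and absolutely convergent complex series *)

(** The real-valued modulus.  The norm of [R[i]] takes its values in [R[i]], where
the order is partial; every estimate below is an inequality in [R]. *)
Definition cabs (R : realType) (z : R[i]) : R := Normc.normc z.
Arguments cabs : simpl never.

Section Modulus.
Context {R : realType}.
Implicit Types (x y z c l m : R[i]) (u v : nat -> R[i]).

Lemma normC_cabs z : `|z| = (cabs z)%:C. Proof. by []. Qed.

Lemma cabs_ge0 z : 0 <= cabs z.
Proof. by rewrite -ler0c -normC_cabs. Qed.

Lemma cabs0 : cabs (0 : R[i]) = 0.
Proof. by apply: (@complexI R); rewrite -normC_cabs normr0. Qed.

Lemma cabs1 : cabs (1 : R[i]) = 1.
Proof. by apply: (@complexI R); rewrite -normC_cabs normr1. Qed.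

Lemma cabs_eq0 z : (cabs z == 0) = (z == 0).
Proof. by rewrite -(inj_eq (@complexI R)) -normC_cabs normr_eq0. Qed.

Lemma cabs_gt0 z : (0 < cabs z) = (z != 0).
Proof. by rewrite lt_def cabs_ge0 andbT cabs_eq0. Qed.

Lemma cabsD x y : cabs (x + y) <= cabs x + cabs y.
Proof. by rewrite -lecR rmorphD -!normC_cabs ler_normD. Qed.

Lemma cabsN x : cabs (- x) = cabs x.
Proof. by apply: (@complexI R); rewrite -!normC_cabs normrN. Qed.

Lemma cabsM x y : cabs (x * y) = cabs x * cabs y.
Proof. by apply: (@complexI R); rewrite rmorphM -!normC_cabs normrM. Qed.

Lemma cabsV x : cabs x^-1 = (cabs x)^-1.
Proof. exact: Normc.normcV. Qed.

Lemma cabsX x n : cabs (x ^+ n) = cabs x ^+ n.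
Proof. by elim: n => [|n IH]; rewrite ?expr0 ?cabs1 // !exprS cabsM IH. Qed.

Lemma cabsB x y : cabs (x - y) = cabs (y - x).
Proof. by rewrite -cabsN opprB. Qed.

Lemma cabs_real (a : R) : cabs a%:C = `|a|.
Proof. by rewrite /cabs /= expr0n addr0 sqrtr_sqr. Qed.

Lemma cabs_nat n : cabs (n%:R : R[i]) = n%:R.
Proof. by rewrite -(rmorph_nat (real_complex R)) cabs_real ger0_norm. Qed.

Lemma cabsJ z : cabs z^* = cabs z.
Proof. by apply: (@complexI R); rewrite -!normC_cabs normcJ. Qed.

Lemma cabs_sum (I : Type) (r : seq I) (P : pred I) (F : I -> R[i]) :
  cabs (\sum_(i <- r | P i) F i) <= \sum_(i <- r | P i) cabs (F i).
Proof.
elim/big_rec2: _ => [|i a b _ h]; first by rewrite cabs0.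
by rewrite (le_trans (cabsD _ _))// lerD2l.
Qed.

Lemma cabs_distD x y z : cabs (x - z) <= cabs (x - y) + cabs (y - z).
Proof. by rewrite (_ : x - z = (x - y) + (y - z)) ?cabsD//; ring. Qed.

Lemma cabs_dist_dist x y : `|cabs x - cabs y| <= cabs (x - y).
Proof.
have h (a b : R[i]) : cabs a - cabs b <= cabs (a - b).
  by have := cabsD (a - b) b; rewrite subrK lerBlDr.
by rewrite ler_norml h andbT lerNl opprB cabsB h.
Qed.

Lemma ReD x y : complex.Re (x + y) = complex.Re x + complex.Re y.
Proof. by case: x y => [? ?] [? ?]. Qed.

Lemma ImD x y : complex.Im (x + y) = complex.Im x + complex.Im y.
Proof. by case: x y => [? ?] [? ?]. Qed.

Lemma ReB x y : complex.Re (x - y) = complex.Re x - complex.Re y.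
Proof. by case: x y => [? ?] [? ?]. Qed.

Lemma ImB x y : complex.Im (x - y) = complex.Im x - complex.Im y.
Proof. by case: x y => [? ?] [? ?]. Qed.

Lemma ReM x y : complex.Re (x * y) =
  complex.Re x * complex.Re y - complex.Im x * complex.Im y.
Proof. by case: x y => ? ? []. Qed.

Lemma ImM x y : complex.Im (x * y) =
  complex.Re x * complex.Im y + complex.Im x * complex.Re y.
Proof. by case: x y => ? ? []. Qed.

Lemma Re_sum (I : Type) (r : seq I) (P : pred I) (F : I -> R[i]) :
  complex.Re (\sum_(i <- r | P i) F i) = \sum_(i <- r | P i) complex.Re (F i).
Proof. by elim/big_rec2: _ => // i a b _ <-; rewrite ReD. Qed.

Lemma Im_sum (I : Type) (r : seq I) (P : pred I) (F : I -> R[i]) :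
  complex.Im (\sum_(i <- r | P i) F i) = \sum_(i <- r | P i) complex.Im (F i).
Proof. by elim/big_rec2: _ => // i a b _ <-; rewrite ImD. Qed.

Lemma cabs_Re z : `|complex.Re z| <= cabs z.
Proof. by rewrite -lecR; exact: normc_ge_Re. Qed.

Lemma cabs_Im z : `|complex.Im z| <= cabs z.
Proof.
rewrite (_ : complex.Im z = - complex.Re (z * 'i)); last by rewrite ReiNIm opprK.
rewrite normrN (le_trans (cabs_Re _))// cabsM (_ : cabs 'i = 1) ?mulr1//.
by rewrite /cabs /= expr0n add0r expr1n sqrtr1.
Qed.

Lemma cabs_le_ReIm z : cabs z <= `|complex.Re z| + `|complex.Im z|.
Proof.
rewrite {1}(complexE z) (le_trans (cabsD _ _))// cabsM !cabs_real.
rewrite (_ : cabs 'i = 1) ?mul1r//.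
by rewrite /cabs /= expr0n add0r expr1n sqrtr1.
Qed.

Lemma ltC_cabs z (e : R) : (`|z| < e%:C) = (cabs z < e).
Proof. by rewrite normC_cabs ltcR. Qed.

Lemma leC_cabs z (e : R) : (`|z| <= e%:C) = (cabs z <= e).
Proof. by rewrite normC_cabs lecR. Qed.

Lemma unit_discE z : unit_disc z <-> cabs z < 1.
Proof. by rewrite /unit_disc /= -ltC_cabs. Qed.

Lemma gt0_complexP (e : R[i]) : 0 < e -> exists2 d : R, 0 < d & e = d%:C.
Proof.
case: e => a b; rewrite ltcE => /andP[/= /eqP -> a0]; by exists a.
Qed.

(** Reduces limits in [R[i]] to real epsilons. *)
Lemma cvg_cabsP u l :
  u @ \oo --> l <-> forall e : R, 0 < e -> \forall n \near \oo, cabs (u n - l) < e.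
Proof.
split=> [/cvgrPdist_lt h e e0|h].
  have := h e%:C; rewrite ltcR => /(_ e0); apply: filterS => n.
  by rewrite ltC_cabs cabsB.
apply/cvgrPdist_lt => _ /gt0_complexP[e e0 ->].
by have := h e e0; apply: filterS => n; rewrite ltC_cabs cabsB.
Qed.

Lemma cvg_cabs u l : u @ \oo --> l -> cabs (u n) @[n --> \oo] --> cabs l.
Proof.
move=> /cvg_cabsP h; apply/cvgrPdist_lt => e e0.
have := h e e0; apply: filterS => n; apply: le_lt_trans.
by rewrite distrC cabs_dist_dist.
Qed.

Lemma cabs_lim_le u l c (B : R) : u @ \oo --> l ->
  (\forall n \near \oo, cabs (u n - c) <= B) -> cabs (l - c) <= B.
Proof.
move=> ul uB.
rewrite leNgt; apply/negP => Bl.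
have e0 : 0 < cabs (l - c) - B by rewrite subr_gt0.
move/cvg_cabsP : ul => /(_ _ e0) ul.
have [n [ucB ule]] := filter_ex (filterI uB ul).
have := cabs_distD l (u n) c; rewrite leNgt => /negP; apply.
by rewrite cabsB -ltrBrDr (lt_le_trans ule)// lerB.
Qed.

Lemma cvgD_C u v l m : u @ \oo --> l -> v @ \oo --> m ->
  (fun n => u n + v n) @ \oo --> l + m.
Proof.
move=> /cvg_cabsP hu /cvg_cabsP hv; apply/cvg_cabsP => e e0.
have e2 : 0 < e / 2 by rewrite divr_gt0.
have := hu _ e2; have := hv _ e2; apply: filterS2 => n h1 h2.
rewrite (_ : u n + v n - (l + m) = (u n - l) + (v n - m)); last by ring.
by rewrite (le_lt_trans (cabsD _ _))// [ltRHS](splitr e) ltrD.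
Qed.

Lemma cvg_cst_C c : (fun=> c) @ \oo --> c.
Proof.
apply/cvg_cabsP => e e0; near=> n; by rewrite subrr cabs0.
Unshelve. all: by end_near. Qed.

Lemma cvgZ_C u l c : u @ \oo --> l -> (fun n => c * u n) @ \oo --> c * l.
Proof.
move=> /cvg_cabsP hu; apply/cvg_cabsP => e e0.
have c0 : 0 < cabs c + 1 by rewrite ltr_wpDl ?cabs_ge0.
have := hu _ (divr_gt0 e0 c0); apply: filterS => n h.
rewrite -mulrBr cabsM (@le_lt_trans _ _ ((cabs c + 1) * cabs (u n - l)))//.
  by rewrite ler_wpM2r ?cabs_ge0// lerDl.
by rewrite mulrC -ltr_pdivlMr.
Qed.

Lemma cvg_ReIm u (a b : R) : complex.Re (u n) @[n --> \oo] --> a ->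
  complex.Im (u n) @[n --> \oo] --> b -> u @ \oo --> a +i* b.
Proof.
move=> /cvgrPdist_lt ha /cvgrPdist_lt hb; apply/cvg_cabsP => e e0.
have e2 : 0 < e / 2 by rewrite divr_gt0.
have := ha _ e2; have := hb _ e2; apply: filterS2 => n hn1 hn2.
rewrite (le_lt_trans (cabs_le_ReIm _))// [ltRHS](splitr e) ltrD//.
  by rewrite ReB distrC.
by rewrite ImB distrC.
Qed.

End Modulus.

Lemma series_ord (V : zmodType) (x : nat -> V) N :
  series x N = \sum_(n < N) x n.
Proof. by rewrite /series /= big_mkord. Qed.

Section AbsSummable.
Context {R : realType}.
Implicit Types (x y : nat -> R[i]) (B S : R).

(** The bound is a parameter rather than existentially quantified, because the
estimates below keep track of it through rearrangements. *)
Definition abs_summable x B := forall N, \sum_(n < N) cabs (x n) <= B.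

Definition csum x : R[i] := limn (series x).

Lemma abs_summable_cvg x B : abs_summable x B -> series x @ \oo --> csum x.
Proof.
move=> xB.
have aux (y : nat -> R) : (forall n, `|y n| <= cabs (x n)) -> cvgn (series y).
  move=> yx; apply: normed_cvg; apply: nondecreasing_is_cvgn.
    by apply: nondecreasing_series => n _ _; exact: normr_ge0.
  exists B => _ [N _ <-]; rewrite /normed_series_of series_ord.
  by rewrite (le_trans _ (xB N))//; apply: ler_sum => i _; exact: yx.
have /cvg_ex[/= a ha] := aux _ (fun n => cabs_Re (x n)).
have /cvg_ex[/= b hb] := aux _ (fun n => cabs_Im (x n)).
have h : series x @ \oo --> a +i* b.
  apply: cvg_ReIm.
    apply: cvg_trans ha; apply: near_eq_cvg; near=> n.
    by rewrite /series /= Re_sum.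
  apply: cvg_trans hb; apply: near_eq_cvg; near=> n.
  by rewrite /series /= Im_sum.
rewrite /csum (_ : limn _ = a +i* b)//; apply/cvg_lim => //.
Unshelve. all: by end_near. Qed.

Lemma abs_summable_cvg_ord x B :
  abs_summable x B -> (fun N => \sum_(n < N) x n) @ \oo --> csum x.
Proof.
by move=> /abs_summable_cvg; rewrite (_ : series x = fun N => \sum_(n < N) x n)//;
  apply/funext => N; rewrite series_ord.
Qed.

Lemma csum_eq x l : series x @ \oo --> l -> csum x = l.
Proof. by move=> h; apply/cvg_lim => //; exact: norm_hausdorff. Qed.

Lemma abs_summable_dom x (b : nat -> R) B :
  (forall n, cabs (x n) <= b n) -> (forall N, \sum_(n < N) b n <= B) ->
  abs_summable x B.
Proof. by move=> xb bB N; rewrite (le_trans _ (bB N))// ler_sum. Qed.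

(** Stated for a majorant [b]: the triangular sums of a double series are dominated
by the sums of moduli, not by the moduli of the sums. *)
Lemma csum_tail x (b : nat -> R) B N :
  (forall n, cabs (x n) <= b n) -> (forall N, \sum_(n < N) b n <= B) ->
  cabs (csum x - \sum_(n < N) x n) <= B - \sum_(n < N) b n.
Proof.
move=> xb bB.
apply: cabs_lim_le (abs_summable_cvg (abs_summable_dom xb bB)) _.
exists N => // n /= Nn; rewrite series_ord.
rewrite -(subnKC Nn) !big_split_ord /= addrAC subrr add0r.
rewrite (le_trans (cabs_sum _ _ _))// lerBrDl.
have := bB (N + (n - N))%N; rewrite big_split_ord; apply: le_trans.
by rewrite lerD2l; apply: ler_sum => i _; exact: xb.
Qed.

Arguments csum_tail {x b B} N.

Lemma csum_le x B : abs_summable x B -> cabs (csum x) <= B.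
Proof. by move=> /(csum_tail 0 (fun n => lexx _)); rewrite !big_ord0 !subr0. Qed.

(** The least bound makes the tails of the series of moduli small. *)
Lemma abs_summable_sup x B : abs_summable x B -> exists S,
  [/\ abs_summable x S, S <= B &
    forall e, 0 < e -> exists N0, forall N, (N0 <= N)%N ->
      S - \sum_(n < N) cabs (x n) < e].
Proof.
move=> xB; pose u N := \sum_(n < N) cabs (x n).
have nd : nondecreasing_seq u.
  apply/nondecreasing_seqP => n; rewrite /u big_ord_recr /= lerDl.
  exact: cabs_ge0.
have ub : has_ubound (range u) by exists B => _ [N _ <-]; exact: xB.
have cu := nondecreasing_cvgn nd ub.
exists (sup (range u)); split.
- by move=> N; apply: ub_le_sup => //; exists N.
- apply: ge_sup; first by exists (u 0), 0.
  by move=> _ [N _ <-]; exact: xB.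
- move=> e e0; move/cvgrPdist_lt : cu => /(_ _ e0)[N0 _ h].
  exists N0 => N /h; apply: le_lt_trans; exact: ler_norm.
Qed.

Lemma abs_summable_le x (y : nat -> R[i]) B :
  (forall n, cabs (x n) <= cabs (y n)) -> abs_summable y B -> abs_summable x B.
Proof. by move=> h yB N; rewrite (le_trans _ (yB N))// ler_sum. Qed.

Lemma abs_summableZ x B c :
  abs_summable x B -> abs_summable (fun n => c * x n) (cabs c * B).
Proof.
move=> h N; under eq_bigr do rewrite cabsM.
by rewrite -mulr_sumr ler_wpM2l ?cabs_ge0.
Qed.

Lemma csumZ x B c : abs_summable x B -> csum (fun n => c * x n) = c * csum x.
Proof.
move=> h; apply: csum_eq.
rewrite (_ : series _ = (fun n => c * series x n)); last first.
  by apply/funext => n; rewrite !series_ord mulr_sumr.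
by apply: cvgZ_C; exact: abs_summable_cvg h.
Qed.

Lemma csumD x y B S : abs_summable x B -> abs_summable y S ->
  csum (fun n => x n + y n) = csum x + csum y.
Proof.
move=> h1 h2; apply: csum_eq.
rewrite (_ : series _ = (fun n => series x n + series y n)); last first.
  by apply/funext => n; rewrite !series_ord big_split.
by apply: cvgD_C; [exact: abs_summable_cvg h1|exact: abs_summable_cvg h2].
Qed.

Lemma eq_csum x y : x =1 y -> csum x = csum y.
Proof. by move=> /funext ->. Qed.

Lemma abs_summableS x B : abs_summable x B -> abs_summable (fun n => x n.+1) B.
Proof.
move=> h N; rewrite (le_trans _ (h N.+1))// big_ord_recl /= lerDr.
exact: cabs_ge0.
Qed.

Lemma csum_recl x B : abs_summable x B ->
  csum x = x 0%N + csum (fun n => x n.+1).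
Proof.
move=> h; have h1 := abs_summable_cvg (abs_summableS h).
apply: csum_eq; apply/cvg_cabsP => e e0.
move/cvg_cabsP : h1 => /(_ e e0)[N _ hN]; exists N.+1 => // -[//|n] /= Nn.
have := hN n Nn; rewrite !series_ord big_ord_recl /=.
rewrite (_ : x 0%N + _ - _ = \sum_(i < n) x i.+1 - csum (fun n => x n.+1)) //.
by ring.
Qed.

End AbsSummable.

(** * Double series *)

Section DoubleSeries.

Lemma sum_triangle (V : nmodType) (F : nat -> nat -> V) N :
  \sum_(n < N) \sum_(j < n.+1) F j (n - j)%N =
  \sum_(m < N) \sum_(j < N - m) F j m.
Proof.
elim: N => [|N IH]; first by rewrite !big_ord0.
rewrite big_ord_recr /= {}IH.
have -> : \sum_(j < N.+1) F j (N - j)%N = \sum_(j < N.+1) F (N - j)%N j.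
  rewrite (reindex_inj rev_ord_inj) /=; apply: eq_bigr => j _.
  by rewrite subSS subKn// -ltnS.
have -> : \sum_(m < N.+1) \sum_(j < N.+1 - m) F j m =
   \sum_(m < N.+1) (\sum_(j < N - m) F j m + F (N - m)%N m).
  apply: eq_bigr => m _; by rewrite subSn ?big_ord_recr // -ltnS.
by rewrite big_split /= [X in _ = X + _]big_ord_recr /= subnn big_ord0 addr0.
Qed.

Context {R : realType}.
Implicit Types (x : nat -> nat -> R[i]) (B S : R).

Definition diag x n := \sum_(j < n.+1) x j (n - j)%N.

Definition diag_abs_summable x B :=
  forall N, \sum_(n < N) \sum_(j < n.+1) cabs (x j (n - j)%N) <= B.

Lemma ler_sum_widen (F : nat -> R) a b : (forall n, 0 <= F n) -> (a <= b)%N ->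
  \sum_(n < a) F n <= \sum_(n < b) F n.
Proof.
move=> F0 ab; rewrite -(subnKC ab) big_split_ord /= lerDl.
by apply: sumr_ge0 => i _.
Qed.

Lemma rect_le_triangle x M J :
  \sum_(m < M) \sum_(j < J) cabs (x j m) <=
  \sum_(n < M + J) \sum_(j < n.+1) cabs (x j (n - j)%N).
Proof.
rewrite (sum_triangle (fun j m => cabs (x j m))).
apply: le_trans (ler_sum_widen (F := fun m => \sum_(j < M + J - m) cabs (x j m)) _ (leq_addr J M)).
  apply: ler_sum => m _; apply: (ler_sum_widen (F := fun j => cabs (x j m))) => //.
    by move=> ?; exact: cabs_ge0.
  by have := ltn_ord m; lia.
by move=> n; apply: sumr_ge0 => *; exact: cabs_ge0.
Qed.

Lemma triangle_le_rect x N :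
  \sum_(n < N) \sum_(j < n.+1) cabs (x j (n - j)%N) <=
  \sum_(m < N) \sum_(j < N) cabs (x j m).
Proof.
rewrite (sum_triangle (fun j m => cabs (x j m))).
apply: ler_sum => m _; apply: (ler_sum_widen (F := fun j => cabs (x j m))) => //.
  by move=> ?; exact: cabs_ge0.
by lia.
Qed.

(** A rectangle minus the triangle it contains involves each remaining term once,
so the difference of sums is at most the difference of sums of moduli. *)
Lemma rect_sub_triangle x N M J : (N <= M)%N -> (N <= J)%N ->
  cabs (\sum_(m < M) \sum_(j < J) x j m - \sum_(n < N) diag x n) <=
  \sum_(m < M) \sum_(j < J) cabs (x j m) -
  \sum_(n < N) \sum_(j < n.+1) cabs (x j (n - j)%N).
Proof.
move=> NM NJ.
have tri (V : zmodType) (F : nat -> nat -> V) :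
    \sum_(n < N) \sum_(j < n.+1) F j (n - j)%N =
    \sum_(m < M) \sum_(j < N - m) F j m.
  rewrite sum_triangle -[M in RHS](subnKC NM) big_split_ord /=.
  rewrite [X in _ = _ + X]big1 ?addr0// => i _.
  by rewrite subnDA subnn sub0n big_ord0.
rewrite /diag tri (tri _ (fun j m => cabs (x j m))) -!sumrB.
apply: le_trans (cabs_sum _ _ _) _; apply: ler_sum => m _.
have NmJ : (N - m <= J)%N by lia.
rewrite -(subnKC NmJ) !big_split_ord /= ![_ + _ - _]addrAC !subrr !add0r.
exact: cabs_sum.
Qed.

Lemma row_abs_summable x B m :
  diag_abs_summable x B -> abs_summable (x ^~ m) B.
Proof.
move=> xB J; apply: le_trans (xB (m.+1 + J)%N).
apply: le_trans (rect_le_triangle _ _ _).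
rewrite big_ord_recr /= lerDr; apply: sumr_ge0 => i _.
by apply: sumr_ge0 => *; exact: cabs_ge0.
Qed.

Lemma diag_summable x B : diag_abs_summable x B -> abs_summable (diag x) B.
Proof.
by move=> xB N; apply: le_trans (xB N); apply: ler_sum => i _; exact: cabs_sum.
Qed.

Lemma cvg_sum_csum (x : nat -> nat -> R[i]) M :
  (forall m, exists B, abs_summable (x ^~ m) B) ->
  (fun J => \sum_(m < M) \sum_(j < J) x j m) @ \oo -->
  \sum_(m < M) csum (x ^~ m).
Proof.
move=> xs; elim: M => [|M IH].
  under eq_fun do rewrite big_ord0.
  by rewrite big_ord0; exact: cvg_cst_C.
under eq_fun do rewrite big_ord_recr /=.
rewrite big_ord_recr; apply: (cvgD_C IH).
by have [B /abs_summable_cvg_ord] := xs M.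
Qed.

Lemma rows_sub_triangle x B N M : diag_abs_summable x B -> (N <= M)%N ->
  cabs (\sum_(m < M) csum (x ^~ m) - \sum_(n < N) diag x n) <=
  B - \sum_(n < N) \sum_(j < n.+1) cabs (x j (n - j)%N).
Proof.
move=> xB NM.
have xs m : exists B, abs_summable (x ^~ m) B.
  by exists B; exact: row_abs_summable.
apply: (cabs_lim_le (cvg_sum_csum (M := M) xs)).
exists N => // J /= NJ; apply: le_trans (rect_sub_triangle _ NM NJ) _.
by rewrite lerD2r (le_trans (rect_le_triangle _ _ _))//; exact: xB.
Qed.

Lemma rows_summable x B : diag_abs_summable x B ->
  abs_summable (fun m => csum (x ^~ m)) B.
Proof.
move=> xB M.
have cv : (fun J => \sum_(m < M) cabs (\sum_(j < J) x j m)) @ \oo -->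
          \sum_(m < M) cabs (csum (x ^~ m)).
  elim: M => [|M IH].
    under eq_fun do rewrite big_ord0.
    by rewrite big_ord0; exact: cvg_cst.
  under eq_fun do rewrite big_ord_recr /=.
  rewrite big_ord_recr; apply: (cvgD IH); apply: cvg_cabs.
  exact: abs_summable_cvg_ord (row_abs_summable M xB).
apply: (cvgr_to_le cv); near=> J.
apply: le_trans (xB (M + J)%N); apply: le_trans (rect_le_triangle _ _ _).
by apply: ler_sum => m _; exact: cabs_sum.
Unshelve. all: by end_near. Qed.

(** A large triangle [n < N] carries almost all the mass of the family, so every
rectangle containing it has nearly the same sum; letting the rows become
infinite compares the partial sums of the row sums with those of the diagonals. *)
Lemma double_series x B : diag_abs_summable x B ->
  csum (fun m => csum (x ^~ m)) = csum (diag x).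
Proof.
move=> xB.
pose a n : R[i] := (\sum_(j < n.+1) cabs (x j (n - j)%N))%:C.
have aE n : cabs (a n) = \sum_(j < n.+1) cabs (x j (n - j)%N).
  by rewrite cabs_real ger0_norm// sumr_ge0// => *; exact: cabs_ge0.
have aB : abs_summable a B.
  by move=> N; under eq_bigr do rewrite aE; exact: xB.
have [S [aS _ hS]] := abs_summable_sup aB.
have xS : diag_abs_summable x S.
  by move=> N; have := aS N; under eq_bigr do rewrite aE.
apply: csum_eq; apply/cvg_cabsP => e e0.
have e2 : 0 < e / 2 by rewrite divr_gt0.
have [N0 /(_ N0 (leqnn _))] := hS _ e2.
under eq_bigr do rewrite aE; move=> hN.
exists N0 => // M /= NM; rewrite series_ord.
apply: le_lt_trans (cabs_distD _ (\sum_(n < N0) diag x n) _) _.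
rewrite [ltRHS](splitr e) ltrD//.
  by apply: le_lt_trans hN; exact: rows_sub_triangle.
rewrite cabsB; apply: le_lt_trans hN; apply: (csum_tail (b := fun n => \sum_(j < n.+1) cabs (x j (n - j)%N))) xS.
by move=> n; exact: cabs_sum.
Qed.

End DoubleSeries.

(** * Power series and the Cauchy estimate *)

Section PowerSeries.
Context {R : realType}.
Implicit Types (a b : nat -> R[i]) (z w h : R[i]) (r s B M : R).

Definition ps a z : R[i] := csum (fun n => a n * z ^+ n).

(** The radius of convergence is at least [r]: absolute convergence at every smaller
radius. *)
Definition pconv a r := forall s, 0 <= s -> s < r ->
  exists B, forall N, \sum_(n < N) cabs (a n) * s ^+ n <= B.

Lemma pconv_abs a r z : pconv a r -> cabs z < r ->
  exists B, abs_summable (fun n => a n * z ^+ n) B.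
Proof.
move=> ar zr; have [B aB] := ar _ (cabs_ge0 z) zr; exists B.
apply: (abs_summable_dom (b := fun n => cabs (a n) * cabs z ^+ n)) => // n.
by rewrite cabsM cabsX.
Qed.

Lemma pconvW a r s : pconv a r -> s <= r -> pconv a s.
Proof. by move=> ar sr t t0 ts; apply: ar => //; exact: lt_le_trans sr. Qed.

Lemma sum_geometric_le (q : R) N : 0 <= q -> q < 1 ->
  \sum_(n < N) q ^+ n <= (1 - q)^-1.
Proof.
move=> q0 q1; have q1' : 0 < 1 - q by rewrite subr_gt0.
rewrite -[leRHS]mul1r ler_pdivlMr//.
have -> : (\sum_(n < N) q ^+ n) * (1 - q) = 1 - q ^+ N.
  have := subrX1 q N; set S := \sum_(i < N) _; nra.
by rewrite lerBlDr lerDl exprn_ge0.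
Qed.

(** Abel's lemma: comparison with a geometric series. *)
Lemma pconv_of_bounded a r B : (forall n, cabs (a n) * r ^+ n <= B) -> pconv a r.
Proof.
move=> aB s s0 sr; have r0 : 0 < r by exact: le_lt_trans sr.
exists (B * (1 - s / r)^-1) => N.
apply: (@le_trans _ _ (\sum_(n < N) B * (s / r) ^+ n)).
  apply: ler_sum => n _.
  rewrite (_ : cabs (a n) * s ^+ n = cabs (a n) * r ^+ n * (s / r) ^+ n).
    by rewrite ler_wpM2r// exprn_ge0// divr_ge0// ltW.
  by rewrite -mulrA -exprMn mulrC [r * _]mulrC divfK ?gt_eqF// mulrC.
rewrite -mulr_sumr ler_wpM2l//; last first.
  by apply: sum_geometric_le; rewrite ?divr_ge0 ?(ltW r0)// ltr_pdivrMr ?mul1r.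
by have := aB 0%N; rewrite expr0 mulr1; apply: le_trans; exact: cabs_ge0.
Qed.

Lemma cvg_series_bounded (x : nat -> R[i]) (l : R[i]) : series x @ \oo --> l ->
  exists B, forall n, cabs (x n) <= B.
Proof.
move=> /cvg_cabsP /(_ 1 ltr01)[N _ hN].
exists (2 + \sum_(n < N) cabs (x n)) => n; have [nN|Nn] := ltnP n N.
  rewrite (bigD1 (Ordinal nN)) //= addrCA lerDl addr_ge0// sumr_ge0// => i _.
  exact: cabs_ge0.
rewrite (@le_trans _ _ 2)//; last first.
  by rewrite lerDl sumr_ge0// => i _; exact: cabs_ge0.
have h1 := hN _ Nn; have h2 := hN _ (leqW Nn).
rewrite /= series_ord in h1; rewrite /= series_ord big_ord_recr /= in h2.
set S := \sum_(i < n) x i in h1 h2.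
rewrite (_ : x n = (S + x n - l) + (l - S)); last by ring.
rewrite (le_trans (cabsD _ _))// [cabs (l - S)]cabsB.
by rewrite -[leRHS]/(1 + 1) lerD// ltW.
Qed.

Lemma pconv_of_cvg a r :
  (forall z, cabs z < r -> exists l : R[i], series (fun n => a n * z ^+ n) @ \oo --> l) ->
  pconv a r.
Proof.
move=> ha s s0 sr; pose t := (s + r) / 2.
have st : s < t by rewrite /t; lra.
have tr : t < r by rewrite /t; lra.
have t0 : 0 <= t by lra.
have ct : cabs (t%:C) = t by rewrite cabs_real ger0_norm.
have [l /cvg_series_bounded[B hB]] := ha t%:C (eq_ind_r (fun u => u < r) tr ct).
have : pconv a t.
  by apply: (@pconv_of_bounded _ _ B) => n; rewrite -[t]ct -cabsX -cabsM.
exact.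
Qed.

Lemma prim_root_exists N : (0 < N)%N -> exists w : R[i], N.-primitive_root w.
Proof.
move=> N0; pose p : {poly R[i]} := 'X^N - 1.
have [rs Drs] := closed_field_poly_normal p.
have lp : lead_coef p = 1 by exact/monicP/monicXnsubC.
rewrite lp scale1r in Drs.
have szp : size p = N.+1 by exact/size_XnsubC.
have rsN : size rs = N.
  by have := szp; rewrite Drs size_prod_XsubC => -[].
have : has N.-primitive_root rs.
  apply: has_prim_root => //; last by rewrite rsN.
    by apply/allP => x xrs; rewrite unity_rootE -subr_eq0; move: (root_prod_XsubC rs x);
     rewrite -Drs xrs /root !hornerE.
  rewrite -separable_prod_XsubC -Drs separable_Xn_sub_1//.
  by rewrite pnatr_eq0 -lt0n.
by move=> /hasP[w _ hw]; exists w.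
Qed.

Lemma cabs_unity_root N w : (0 < N)%N -> w ^+ N = 1 -> cabs w = 1.
Proof.
move=> N0 wN; apply/eqP; rewrite -(@eqrXn2 _ N _ 1)// ?cabs_ge0//.
by rewrite -cabsX wN cabs1 expr1n.
Qed.

Lemma sum_prim_root_pow N w m : N.-primitive_root w ->
  \sum_(k < N) (w ^+ k) ^+ m = if (N %| m)%N then N%:R else 0.
Proof.
move=> wN; under eq_bigr do rewrite exprAC.
case: ifP => [Nm|Nm].
  have -> : w ^+ m = 1 by apply/eqP; rewrite -(prim_order_dvd wN).
  under eq_bigr do rewrite expr1n.
  by rewrite sumr_const card_ord.
have /eqP : (w ^+ m - 1) * \sum_(k < N) (w ^+ m) ^+ k = 0.
  by rewrite -subrX1 exprAC (prim_expr_order wN) expr1n subrr.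
by rewrite mulf_eq0 subr_eq0 -(prim_order_dvd wN) Nm /= => /eqP.
Qed.

(** Discrete Fourier inversion: the average of [P(w^k) w^(-kn)] over the [N]-th
roots of unity is the [n]-th coefficient of a polynomial [P] of degree less
than [N]. *)
Lemma coef_of_poly_values N w (c : nat -> R[i]) n : N.-primitive_root w ->
  (n < N)%N ->
  \sum_(k < N) (w ^+ k) ^+ (N - n) * \sum_(j < N) c j * (w ^+ k) ^+ j =
  N%:R * c n.
Proof.
move=> wN nN.
transitivity (\sum_(j < N) c j * \sum_(k < N) (w ^+ k) ^+ (N - n + j)).
  under eq_bigr do rewrite mulr_sumr.
  rewrite exchange_big /=; apply: eq_bigr => j _.
  by rewrite mulr_sumr; apply: eq_bigr => k _; rewrite exprD; ring.
rewrite (bigD1 (Ordinal nN)) //= [X in _ + X]big1 ?addr0.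
  by rewrite (sum_prim_root_pow _ wN) subnK ?(ltnW nN)// dvdnn mulrC.
move=> j jn; rewrite (sum_prim_root_pow _ wN); case: ifP => //; last by rewrite mulr0.
move=> /dvdnP[q hq]; exfalso; move/eqP: jn; apply; apply: val_inj => /=.
have := ltn_ord j; move: hq; case: q => [|[|q]]; nia.
Qed.

(** The polynomial case is an average over roots of unity; a series is within an
arbitrarily small distance of a truncation on the whole circle [|z| = s]. *)
Lemma cauchy_estimate a r s M n : pconv a r -> 0 <= s -> s < r ->
  (forall z, cabs z = s -> cabs (ps a z) <= M) -> cabs (a n) * s ^+ n <= M.
Proof.
move=> ar s0 sr hM; rewrite leNgt; apply/negP => hlt.
pose e := cabs (a n) * s ^+ n - M; have e0 : 0 < e by rewrite subr_gt0.
have [B0 aB0] := ar _ s0 sr.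
pose x n := a n * s%:C ^+ n.
have xn k : cabs (x k) = cabs (a k) * s ^+ k.
  by rewrite cabsM cabsX cabs_real ger0_norm.
have xB0 : abs_summable x B0 by move=> N; under eq_bigr do rewrite xn; exact: aB0.
have [B [xB _ /(_ _ e0)[N0 hN0]]] := abs_summable_sup xB0.
(* [N0] makes the tail smaller than [e]; the degree has to exceed [n] as well. *)
pose N := (N0 + n.+1)%N.
have nN : (n < N)%N by rewrite /N; lia.
have N_gt0 : (0 < N)%N by lia.
have {hN0}hN := hN0 N (leq_addr _ _).
have [w wN] := prim_root_exists N_gt0.
have wabs : cabs w = 1 by apply: (cabs_unity_root N_gt0); exact: prim_expr_order.
have wk k : cabs (w ^+ k) = 1 by rewrite cabsX wabs expr1n.
have val k : cabs (\sum_(j < N) x j * (w ^+ k) ^+ j) <= M + (B - \sum_(j < N) cabs (x j)).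
  pose y n := x n * (w ^+ k) ^+ n.
  have yx j : cabs (y j) <= cabs (x j) by rewrite cabsM cabsX wk expr1n mulr1.
  have yps : csum y = ps a (s%:C * w ^+ k).
    by apply: eq_csum => j; rewrite /y /x exprMn mulrA.
  have := csum_tail N yx xB; rewrite yps => htail.
  have := hM (s%:C * w ^+ k); rewrite cabsM cabs_real wk mulr1 ger0_norm// => /(_ erefl).
  have := cabs_distD (\sum_(j < N) y j) (ps a (s%:C * w ^+ k)) 0.
  by rewrite !subr0 [cabs (_ - ps _ _)]cabsB; lra.
have := coef_of_poly_values x wN nN => /(congr1 (@cabs R)).
rewrite cabsM cabs_nat xn => hsum.
have : N%:R * (cabs (a n) * s ^+ n) <= N%:R * (M + (B - \sum_(j < N) cabs (x j))).
  rewrite -hsum (le_trans (cabs_sum _ _ _))//.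
  rewrite -[N in N%:R]card_ord mulr_natl -sumr_const; apply: ler_sum => k _.
  by rewrite cabsM cabsX wk expr1n mul1r.
rewrite ler_pM2l ?ltr0n// => h; move: hN; rewrite /e; lra.
Qed.

Lemma pconvB a b r : pconv a r -> pconv b r -> pconv (fun n => a n - b n) r.
Proof.
move=> ar br s s0 sr; have [B aB] := ar s s0 sr; have [B' bB] := br s s0 sr.
exists (B + B') => N; apply: le_trans (lerD (aB N) (bB N)).
rewrite -big_split; apply: ler_sum => i _ /=.
by rewrite -mulrDl ler_wpM2r ?exprn_ge0// (le_trans (cabsD _ _))// cabsN.
Qed.

Lemma psB a b r z : pconv a r -> pconv b r -> cabs z < r ->
  ps (fun n => a n - b n) z = ps a z - ps b z.
Proof.
move=> /pconv_abs ar /pconv_abs br zr; have [A hA] := ar _ zr; have [B hB] := br _ zr.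
rewrite /ps -[- csum _]mulN1r -(csumZ _ hB) -(csumD hA (abs_summableZ _ hB)).
by apply: eq_csum => n; ring.
Qed.

(** The difference of the two series vanishes on a circle, so the Cauchy estimate
with bound 0 kills its coefficients. *)
Lemma ps_unique a b r : 0 < r -> pconv a r -> pconv b r ->
  (forall z, cabs z < r -> ps a z = ps b z) -> a =1 b.
Proof.
move=> r0 ar br ab n; have r2 : r / 2 < r by lra.
have := @cauchy_estimate (fun n => a n - b n) r (r / 2) 0 n (pconvB ar br).
have r20 : 0 < r / 2 by lra.
move=> /(_ (ltW r20) r2) h.
have {}h : cabs (a n - b n) * (r / 2) ^+ n <= 0.
  apply: h => z zr; have zr' : cabs z < r by rewrite zr.
  by rewrite (psB ar br zr') (ab _ zr') subrr cabs0.
apply/eqP; rewrite -subr_eq0 -cabs_eq0 eq_le cabs_ge0 andbT.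
by move: h; rewrite pmulr_lle0// exprn_gt0.
Qed.

End PowerSeries.

(** * Recentering, differentiation and products of power series *)

Section Recentering.
Context {R : realType}.
Implicit Types (a b : nat -> R[i]) (z w h : R[i]) (r s t B M : R).

(** The coefficients of the [k]-th derivative divided by [k!]. *)
Definition dcoef a k j : R[i] := 'C(j + k, j)%:R * a (j + k)%N.

Definition recenter a z k : R[i] := ps (dcoef a k) z.

Definition recenter_term a z h j k : R[i] := dcoef a k j * z ^+ j * h ^+ k.

Lemma diag_recenter_abs a z h n :
  \sum_(j < n.+1) cabs (recenter_term a z h j (n - j)%N) =
  cabs (a n) * (cabs z + cabs h) ^+ n.
Proof.
rewrite addrC exprDn mulr_sumr; apply: eq_bigr => j _.
have jn : (j <= n)%N by rewrite -ltnS.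
rewrite /recenter_term /dcoef subnKC// !cabsM !cabsX cabs_nat -mulr_natr; ring.
Qed.

(** Binomial theorem: the family whose rows are the recentered coefficients has the
terms of the series at [z + h] as its diagonals. *)
Lemma diag_recenter a z h n : diag (recenter_term a z h) n = a n * (z + h) ^+ n.
Proof.
rewrite /diag addrC exprDn mulr_sumr; apply: eq_bigr => j _.
have jn : (j <= n)%N by rewrite -ltnS.
rewrite /recenter_term /dcoef subnKC// -mulr_natr; ring.
Qed.

Lemma recenter_diag_abs_summable a z h t B :
  (forall N, \sum_(n < N) cabs (a n) * t ^+ n <= B) -> cabs z + cabs h <= t ->
  diag_abs_summable (recenter_term a z h) B.
Proof.
move=> aB zht N; apply: le_trans (aB N); apply: ler_sum => n _.
rewrite diag_recenter_abs ler_wpM2l ?cabs_ge0//.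
by rewrite lerXn2r ?nnegrE ?addr_ge0 ?cabs_ge0// (le_trans _ zht)// addr_ge0 ?cabs_ge0.
Qed.

(** At radius [s] these coefficients form a row of the recentering family for any
increment [h > 0] with [s + h < r]. *)
Lemma pconv_dcoef a r k : pconv a r -> pconv (dcoef a k) r.
Proof.
move=> ar s s0 sr; pose t := (s + r) / 2.
have st : 0 < t - s by rewrite /t; lra.
have tr : t < r by rewrite /t; lra.
have [B aB] := ar t ltac:(lra) tr.
have := @recenter_diag_abs_summable a s%:C (t - s)%:C t B aB.
rewrite !cabs_real !ger0_norm ?(ltW st)// addrC subrK lexx => /(_ isT).
move=> /(row_abs_summable k) h; exists (B / (t - s) ^+ k) => N.
rewrite ler_pdivlMr ?exprn_gt0//; apply: le_trans (h N).
rewrite mulr_suml; apply: ler_sum => j _.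
by rewrite /recenter_term !cabsM !cabsX !cabs_real !ger0_norm ?(ltW st).
Qed.

Lemma csum_recenter_row a z h r k : pconv a r -> cabs z < r ->
  csum (recenter_term a z h ^~ k) = recenter a z k * h ^+ k.
Proof.
move=> ar zr; have [B hB] := pconv_abs (pconv_dcoef k ar) zr.
rewrite /recenter /ps mulrC -(csumZ _ hB); apply: eq_csum => j.
by rewrite /recenter_term mulrC.
Qed.

(** The bound does not depend on [z], which is what makes the coefficients of
nearby expansions uniformly bounded. *)
Lemma recenter_bound a z t s B : 0 < s ->
  (forall N, \sum_(n < N) cabs (a n) * t ^+ n <= B) -> cabs z + s <= t ->
  forall N, \sum_(k < N) cabs (recenter a z k) * s ^+ k <= B.
Proof.
move=> s_gt0 aB zst N; have s0 := ltW s_gt0; have zt : cabs z < t by lra.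
have at_ : pconv a t.
  move=> u u0 ut; exists B => N'; apply: le_trans (aB N').
  apply: ler_sum => i _; rewrite ler_wpM2l ?cabs_ge0// lerXn2r ?nnegrE//; lra.
have cs : cabs s%:C = s by rewrite cabs_real ger0_norm.
have := @recenter_diag_abs_summable a z s%:C t B aB; rewrite cs => /(_ zst).
move=> /rows_summable /(_ N); apply: le_trans; apply: ler_sum => k _.
by rewrite (csum_recenter_row _ _ at_ zt) cabsM cabsX cs.
Qed.

Lemma pconv_recenter a r z : pconv a r -> pconv (recenter a z) (r - cabs z).
Proof.
move=> ar s s0 sr; pose u := (s + (r - cabs z)) / 2.
have su : s < u by rewrite /u; lra.
have ur : cabs z + u < r by rewrite /u; lra.
have z0 := cabs_ge0 z.
have [B aB] := ar (cabs z + u) ltac:(lra) ur.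
exists B => N; apply: le_trans (recenter_bound (s := u) _ aB _ N); try lra.
apply: ler_sum => k _; rewrite ler_wpM2l ?cabs_ge0// lerXn2r ?nnegrE//; lra.
Qed.

Lemma ps_recenter a r z h : pconv a r -> cabs z + cabs h < r ->
  ps a (z + h) = ps (recenter a z) h.
Proof.
move=> ar zhr; have z0 := cabs_ge0 z; have h0 := cabs_ge0 h.
have [B aB] := ar _ (addr_ge0 z0 h0) zhr.
have /double_series := recenter_diag_abs_summable aB (lexx _).
rewrite /ps; under [X in _ = X -> _]eq_csum do rewrite diag_recenter.
move=> <-; apply: eq_csum => k; apply: csum_recenter_row ar _; lra.
Qed.

Lemma ps_at0 a : ps a 0 = a 0%N.
Proof.
have s : abs_summable (fun n => a n * 0 ^+ n) (cabs (a 0%N)).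
  case=> [|N]; first by rewrite big_ord0 cabs_ge0.
  rewrite big_ord_recl big1 ?addr0 ?expr0 ?mulr1//= => i _.
  by rewrite expr0n /= mulr0 cabs0.
rewrite /ps (csum_recl s) expr0 mulr1.
suff -> : csum (fun n => a n.+1 * 0 ^+ n.+1) = 0 by rewrite addr0.
apply/eqP; rewrite -cabs_eq0 eq_le cabs_ge0 andbT; apply: csum_le => N.
by rewrite big1// => i _; rewrite expr0n mulr0 cabs0.
Qed.

Lemma recenter0E a z : recenter a z 0 = ps a z.
Proof.
by apply: eq_csum => j; rewrite /dcoef addn0 binn mul1r.
Qed.

Lemma ps_quadratic0 a r : 0 < r -> pconv a r -> exists K d, [/\ 0 <= K, 0 < d, d < r &
  forall h, cabs h <= d -> cabs (ps a h - a 0%N - a 1%N * h) <= K * cabs h ^+ 2].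
Proof.
move=> r0 ar; have [B aB] := ar (r / 2) ltac:(lra) ltac:(lra).
have r2 : 0 < r / 2 by lra.
have B0 : 0 <= B by have := aB 0%N; rewrite big_ord0.
exists (B / (r / 2) ^+ 2), (r / 2); split => //; first by rewrite divr_ge0// exprn_ge0// ltW.
  by lra.
move=> h hd.
have hs : abs_summable (fun n => a n * h ^+ n) B.
  apply: (abs_summable_dom (b := fun n => cabs (a n) * (r / 2) ^+ n)) => // n.
  by rewrite cabsM cabsX ler_wpM2l ?cabs_ge0// lerXn2r ?nnegrE ?cabs_ge0// ltW.
rewrite /ps (csum_recl hs) (csum_recl (abs_summableS hs)) expr0 expr1 mulr1.
rewrite (_ : _ - _ - _ = csum (fun n => a n.+2 * h ^+ n.+2)); last by ring.
have -> : csum (fun n => a n.+2 * h ^+ n.+2) = csum (fun n => h ^+ 2 * (a n.+2 * h ^+ n)).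
  by apply: eq_csum => n; rewrite -[n.+2]addn2 exprD; ring.
have hs2 : abs_summable (fun n => a n.+2 * h ^+ n) (B / (r / 2) ^+ 2).
  move=> N; rewrite ler_pdivlMr ?exprn_gt0//; apply: le_trans (aB N.+2).
  rewrite 2!big_ord_recl /= addrA mulr_suml ler_wpDl//.
    by rewrite addr_ge0// mulr_ge0 ?cabs_ge0 ?exprn_ge0// ltW.
  apply: ler_sum => i _; rewrite cabsM cabsX /bump /= !add1n -[i.+2]addn2 exprD mulrA.
  rewrite ler_wpM2r ?exprn_ge0 ?(ltW r2)// ler_wpM2l ?cabs_ge0//.
  by rewrite lerXn2r ?nnegrE ?cabs_ge0// ltW.
rewrite (csumZ _ hs2) cabsM cabsX mulrC ler_wpM2r ?exprn_ge0 ?cabs_ge0//.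
exact: csum_le.
Qed.

(** Quantitative differentiability, used for the complex derivative and for the
derivative along rays. *)
Lemma ps_quadratic a r z : pconv a r -> cabs z < r ->
  exists K d, [/\ 0 <= K, 0 < d & forall h, cabs h <= d ->
    cabs (ps a (z + h) - ps a z - ps (dcoef a 1) z * h) <= K * cabs h ^+ 2].
Proof.
move=> ar zr; have rz : 0 < r - cabs z by lra.
have [K [d [K0 d0 dr hK]]] := ps_quadratic0 rz (pconv_recenter (z := z) ar).
exists K, d; split => // h hd; have := hK _ hd; rewrite recenter0E.
by rewrite (ps_recenter ar) //; lra.
Qed.

Lemma derive1_of_expansion (f : R[i] -> R[i]) a r z : 0 < r -> pconv a r ->
  (forall h, cabs h < r -> f (z + h) = ps a h) -> derive1 f z = a 1%N.
Proof.
move=> r0 ar fa; have [K [d [K0 d0 dr hK]]] := ps_quadratic0 r0 ar.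
have f0 : f z = a 0%N by have := fa 0; rewrite cabs0 addr0 ps_at0 => /(_ r0).
rewrite /derive1; apply/cvg_lim; first exact: norm_hausdorff.
apply/cvgrPdist_lt => _ /gt0_complexP[e e0 ->].
have K1 : 0 < K + 1 by lra.
have m0 : 0 < Num.min d (e / (K + 1)) by rewrite lt_min d0 divr_gt0.
near=> h; rewrite ltC_cabs.
have h0 : h != 0 by near: h; exact: nbhs_dnbhs_neq.
have hm : cabs h < Num.min d (e / (K + 1)).
  rewrite -ltC_cabs; near: h.
  by apply: dnbhs0_lt; rewrite ltcR.
move: hm; rewrite lt_min => /andP[hd he].
rewrite [h + z]addrC (fa _ (lt_trans hd dr)) f0 -[_ *: _]/(h^-1 * (ps a h - a 0%N)).
have -> : a 1%N - h^-1 * (ps a h - a 0%N) = - (h^-1 * (ps a h - a 0%N - a 1%N * h)).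
  by field.
rewrite cabsN cabsM cabsV ltr_pdivrMl ?cabs_gt0//.
apply: le_lt_trans (hK _ (ltW hd)) _.
rewrite expr2 mulrA [ltRHS]mulrC ltr_pM2r ?cabs_gt0//.
move: he; rewrite ltr_pdivlMr// => he; apply: le_lt_trans he.
by rewrite mulrC ler_wpM2l ?cabs_ge0// lerDl.
Unshelve. all: by end_near. Qed.

Definition cprod a b n : R[i] := \sum_(j < n.+1) a j * b (n - j)%N.

Lemma cprod_diag_abs_summable a b s A B :
  (forall N, \sum_(n < N) cabs (a n) * s ^+ n <= A) ->
  (forall N, \sum_(n < N) cabs (b n) * s ^+ n <= B) ->
  forall z, cabs z = s ->
  diag_abs_summable (fun j m => (a j * z ^+ j) * (b m * z ^+ m)) (A * B).
Proof.
move=> aA bB z zs N.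
apply: (le_trans (triangle_le_rect (fun j m => (a j * z ^+ j) * (b m * z ^+ m)) N)).
have s0 : 0 <= s by rewrite -zs cabs_ge0.
under eq_bigr => m _.
  under eq_bigr do rewrite cabsM [cabs (a _ * _)]cabsM cabsX zs.
  rewrite -mulr_suml; over.
rewrite -mulr_sumr ler_pM//.
  by apply: sumr_ge0 => i _; rewrite mulr_ge0 ?cabs_ge0 ?exprn_ge0.
  by apply: sumr_ge0 => i _; exact: cabs_ge0.
by under eq_bigr do rewrite cabsM cabsX zs.
Qed.

Lemma diag_cprod a b z n :
  diag (fun j m => (a j * z ^+ j) * (b m * z ^+ m)) n = cprod a b n * z ^+ n.
Proof.
rewrite /diag /cprod mulr_suml; apply: eq_bigr => j _.
have jn : (j <= n)%N by rewrite -ltnS.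
have -> : z ^+ n = z ^+ j * z ^+ (n - j) by rewrite -exprD subnKC.
by ring.
Qed.

Lemma pconv_cprod a b r : pconv a r -> pconv b r -> pconv (cprod a b) r.
Proof.
move=> ar br s s0 sr; have [A aA] := ar s s0 sr; have [B bB] := br s s0 sr.
have cs : cabs s%:C = s by rewrite cabs_real ger0_norm.
exists (A * B) => N.
apply: le_trans (diag_summable (cprod_diag_abs_summable aA bB cs) N).
by apply: ler_sum => n _; rewrite diag_cprod cabsM cabsX cs.
Qed.

Lemma ps_cprod a b r z : pconv a r -> pconv b r -> cabs z < r ->
  ps (cprod a b) z = ps a z * ps b z.
Proof.
move=> ar br zr; have z0 := cabs_ge0 z.
have [A aA] := ar _ z0 zr; have [B bB] := br _ z0 zr.
have := double_series (cprod_diag_abs_summable aA bB erefl).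
rewrite /ps; under [X in _ = X -> _]eq_csum do rewrite diag_cprod.
move=> <-; have [A' hA] := pconv_abs ar zr; have [B' hB] := pconv_abs br zr.
rewrite -(csumZ _ hB); apply: eq_csum => m.
rewrite [RHS]mulrC -(csumZ _ hA).
by apply: eq_csum => j; rewrite mulrC.
Qed.

End Recentering.

(** * Analytic functions on the unit disc are sums of one power series *)

Section LocalToGlobal.
Context {R : realType}.
Implicit Types (a b : nat -> R[i]) (z w h : R[i]) (r s t B M : R) (f : R[i] -> R[i]).

(** Convergence of the local series at every point of a disc makes it absolutely
convergent there. *)
Lemma analytic_expansion f z : analytic_on (@unit_disc R) f -> cabs z < 1 ->
  exists b e, [/\ 0 < e, pconv b e & forall h, cabs h < e -> f (z + h) = ps b h].
Proof.
move=> fa /unit_discE /fa[b [e [e0 hb]]]; exists b, e.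
have hb' h : cabs h < e -> series (fun n => b n * h ^+ n) @ \oo --> f (z + h).
  move=> he; have := hb (z + h); rewrite ltC_cabs (_ : z + h - z = h); last by ring.
  exact.
split => // [|h he]; first by apply: pconv_of_cvg => h /hb' ?; exists (f (z + h)).
by apply/esym/csum_eq; exact: hb'.
Qed.

(** One natural number controls both the radius and the coefficients, so that the
condition becomes weaker along [\oo] and compactness applies directly. *)
Definition expands_within f (n : nat) z := exists b : nat -> R[i],
  (forall k, cabs (b k) <= n%:R * n%:R ^+ k) /\
  (forall h, cabs h < n%:R^-1 -> f (z + h) = ps b h).

(** Nearby expansions are recenterings of one expansion, whose coefficients obey a
uniform geometric bound. *)
Lemma expands_within_near f z : analytic_on (@unit_disc R) f -> cabs z < 1 ->
  exists (d : R) N, 0 < d /\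
    forall w n, cabs (w - z) < d -> (N <= n)%N -> expands_within f n w.
Proof.
move=> fa /(analytic_expansion fa)[b [e [e0 be hb]]].
pose s := e / 8; have s0 : 0 < s by rewrite /s; lra.
have [B bB] := be (e / 4) ltac:(lra) ltac:(lra).
have B0 : 0 <= B by have := bB 0%N; rewrite big_ord0.
have [N hN] : exists N : nat, B + s^-1 <= N%:R.
  exists (Num.truncn (B + s^-1)).+1; exact/ltW/truncnS_gt.
have s10 : 0 < s^-1 by rewrite invr_gt0.
exists s, N; split => // w n wzs Nn.
have nR : B + s^-1 <= n%:R by rewrite (le_trans hN)// ler_nat.
have n0 : 0 < n%:R :> R by lra.
have ns : n%:R^-1 <= s by rewrite -[s]invrK lef_pV2 ?posrE//; lra.
exists (recenter b (w - z)); split => [k|h hn].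
  have := @recenter_bound _ b (w - z) (e / 4) s B s0 bB.
  rewrite /s in wzs *; move=> /(_ ltac:(lra) k.+1); rewrite big_ord_recr /=.
  rewrite -/s => hk.
  have : cabs (recenter b (w - z) k) * s ^+ k <= B.
    apply: le_trans hk; rewrite lerDr sumr_ge0// => i _.
    by rewrite mulr_ge0 ?cabs_ge0 ?exprn_ge0// ltW.
  rewrite -ler_pdivlMr ?exprn_gt0// => /le_trans; apply.
  rewrite -exprVn ler_pM ?exprn_ge0 ?(ltW s10)//; first by lra.
  by rewrite lerXn2r ?nnegrE ?(ltW s10) ?(ltW n0)//; lra.
rewrite (_ : w + h = z + ((w - z) + h)); last by ring.
have he : cabs (w - z) + cabs h < e by rewrite /s in ns wzs; lra.
rewrite hb; last exact: le_lt_trans (cabsD _ _) he.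
exact: ps_recenter be he.
Qed.

Lemma expands_within_uniform f rho : analytic_on (@unit_disc R) f -> rho < 1 ->
  exists N, forall n z, (N <= n)%N -> cabs z <= rho -> expands_within f n z.
Proof.
move=> fa rho1.
(* The covering is done on a square: points of modulus greater than [rho] have a
   neighbourhood where the covered property is vacuous. *)
pose K : set (R * R) := `[-1, 1]%classic `*` `[-1, 1]%classic.
have cK : compact K by apply: compact_setX; exact: segment_compact.
pose P (n : nat) (p : R * R) := cabs (p.1 +i* p.2) <= rho ->
  expands_within f n (p.1 +i* p.2).
move/compact_near_coveringP : cK => /(_ nat \oo P _)[].
  move=> [x y] _ /=; have [hr|hr] := leP (cabs (x +i* y)) rho.
    have [d [N [d0 hd]]] := expands_within_near fa (le_lt_trans hr rho1).
    exists (ball (x, y) (d / 2), [set n | (N <= n)%N]) => /=.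
      split; last by exists N.
      by apply: nbhsx_ballx; rewrite divr_gt0.
    move=> [[x' y'] n] /= [[/= hx hy] Nn] _; apply: hd => //.
    rewrite (le_lt_trans (cabs_le_ReIm _))//=.
    by rewrite [ltRHS](splitr d) ltrD// distrC.
  pose d := cabs (x +i* y) - rho; have d0 : 0 < d by rewrite subr_gt0.
  exists (ball (x, y) (d / 2), setT) => /=.
    split; last exact: filterT.
    by apply: nbhsx_ballx; rewrite divr_gt0.
  move=> [[x' y'] n] /= [[/= hx hy] _]; rewrite /P /= => hle; exfalso.
  have : cabs ((x +i* y) - (x' +i* y')) < d.
    rewrite (le_lt_trans (cabs_le_ReIm _))//=.
    by rewrite [ltRHS](splitr d) ltrD.
  have := cabs_distD (x +i* y) (x' +i* y') 0; rewrite !subr0 /d => h1 h2; lra.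
move=> N _ hN; exists N => n z Nn zr.
have := hN n Nn (complex.Re z, complex.Im z); rewrite /P /=.
have -> : complex.Re z +i* complex.Im z = z by case: (z).
apply => //; split => /=; rewrite in_itv /= -ler_norml.
  by apply: le_trans (cabs_Re z) _; lra.
by apply: le_trans (cabs_Im z) _; lra.
Qed.

(** Both series represent [f] on a common disc around [z], where their coefficients
are determined. *)
Lemma expansion_unique f a r z b t : pconv a r ->
  (forall w, cabs w < r -> f w = ps a w) -> cabs z < r -> 0 < t ->
  pconv b t -> (forall h, cabs h < t -> f (z + h) = ps b h) ->
  b =1 recenter a z.
Proof.
move=> ar fa zr t0 bt fb; pose u := Num.min t (r - cabs z).
have u0 : 0 < u by rewrite lt_min t0 subr_gt0.
apply: (@ps_unique _ _ _ u) => //.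
- by apply: pconvW bt _; rewrite ge_min lexx.
- by apply: pconvW (pconv_recenter (z := z) ar) _; rewrite ge_min lexx orbT.
move=> h; rewrite lt_min => /andP[ht hr].
rewrite -fb// -(ps_recenter ar); last by lra.
by apply: fa; apply: le_lt_trans (cabsD _ _) _; lra.
Qed.

(** Expanding [(s + d)^m] by the binomial theorem turns [|a_m| (s + d)^m] into a sum
of the bounded quantities, with weights [2^-k] when [d = 1 / (2 n)]. *)
Lemma pconv_of_dcoef_bounded a s (n : nat) : 0 <= s -> (0 < n)%N ->
  (forall k j, cabs (dcoef a k j) * s ^+ j <= n%:R * n%:R ^+ k) ->
  pconv a (s + (2 * n%:R)^-1).
Proof.
move=> s0 n0 h; have nR : 0 < n%:R :> R by rewrite ltr0n.
pose d : R := (2 * n%:R)^-1; have d0 : 0 < d by rewrite invr_gt0; lra.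
apply: (@pconv_of_bounded _ _ _ (n%:R * 2)) => m.
have := diag_recenter_abs a s%:C d%:C m.
rewrite !cabs_real !ger0_norm ?(ltW d0)// -/d => <-.
apply: (@le_trans _ _ (\sum_(j < m.+1) n%:R * 2^-1 ^+ (m - j))).
  apply: ler_sum => j _; rewrite /recenter_term !cabsM !cabsX !cabs_real.
  rewrite !ger0_norm ?(ltW d0)//.
  apply: (@le_trans _ _ (n%:R * n%:R ^+ (m - j) * d ^+ (m - j))).
    by rewrite -cabsM; apply: ler_wpM2r; [rewrite exprn_ge0// ltW|exact: h].
  rewrite -mulrA -exprMn (_ : n%:R * d = 2^-1)//.
  by rewrite /d; field; lra.
rewrite -mulr_sumr ler_wpM2l ?(ltW nR)//.
rewrite (reindex_inj rev_ord_inj) /= (eq_bigr (fun j : 'I_m.+1 => 2^-1 ^+ j)).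
  apply: le_trans (sum_geometric_le _ _ _) _; [lra|lra|].
  by rewrite (_ : 1 - 2^-1 = 2^-1 :> R) ?invrK//; field.
by move=> j _; rewrite subSS subKn// -ltnS.
Qed.

(** The Cauchy estimate is applied to [z |-> f^(k)(z) / k!] on a circle just inside
[|z| = rho]: its uniform bound controls all Taylor coefficients at 0 beyond
the radius [rho].  On the new annulus the series equals [f] because both have
the same expansion at a nearby point of the old disc. *)
Lemma extend_expansion f a rho : analytic_on (@unit_disc R) f ->
  0 < rho -> rho < 1 -> pconv a rho ->
  (forall z, cabs z < rho -> f z = ps a z) ->
  exists rho', [/\ rho < rho', pconv a rho' & forall z, cabs z < rho' -> f z = ps a z].
Proof.
move=> fa rho0 rho1 ar fE; have [N0 hN0] := expands_within_uniform fa rho1.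
have [n [n0 hn nrho]] : exists n, [/\ (0 < n)%N,
    forall z, cabs z <= rho -> expands_within f n z & n%:R^-1 <= rho].
  exists (N0 + (Num.truncn rho^-1).+1)%N; split; first by rewrite addnS.
    by move=> z; apply: hN0; exact: leq_addr.
  rewrite -[leRHS]invrK lef_pV2 ?posrE ?invr_gt0// ?ltr0n ?addnS//.
  by rewrite -addnS natrD ler_wpDl//; exact/ltW/truncnS_gt.
have nR : 0 < n%:R :> R by rewrite ltr0n.
pose d : R := n%:R^-1; have d0 : 0 < d by rewrite invr_gt0.
have drho : d <= rho by [].
have expn z : cabs z < rho -> [/\ forall k, cabs (recenter a z k) <= n%:R * n%:R ^+ k,
    pconv (recenter a z) d &
    forall h, cabs h < d -> f (z + h) = ps (recenter a z) h].
  move=> zr; have [b [bn fb]] := hn z (ltW zr).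
  have bd : pconv b d.
    apply: (@pconv_of_bounded _ _ _ n%:R) => k.
    by rewrite exprVn ler_pdivrMr ?exprn_gt0.
  by have /funext <- := expansion_unique ar fE zr d0 bd fb.
(* Each coefficient bound is gained on [|z| = s] and lost again by [d / 4], while
   the radius grows by [1 / (2 n) = d / 2]. *)
pose s := rho - d / 4; have s0 : 0 <= s by rewrite /s; lra.
have srho : s < rho by rewrite /s; lra.
have ar' : pconv a (rho + d / 4).
  have -> : rho + d / 4 = s + (2 * n%:R)^-1 by rewrite /s /d; field; lra.
  apply: pconv_of_dcoef_bounded => // k j.
  apply: (cauchy_estimate j (pconv_dcoef k ar) s0 srho) => z zs.
  have zr : cabs z < rho by rewrite zs.
  by have [h _ _] := expn z zr; exact: h.
exists (rho + d / 8); split; first by lra.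
  by apply: pconvW ar' _; lra.
move=> z zr; have [|rz] := ltP (cabs z) rho; first exact: fE.
(* [z0] lies on the segment from 0 to [z], inside the old disc and at distance less
   than [d] from [z]. *)
pose c := (rho - d / 8) / cabs z; pose z0 := c%:C * z.
have z_gt0 : 0 < cabs z by lra.
have c0 : 0 <= c by rewrite divr_ge0//; lra.
have c1 : c <= 1 by rewrite ler_pdivrMr// mul1r; lra.
have z0E : cabs z0 = rho - d / 8.
  by rewrite cabsM cabs_real ger0_norm// divfK// gt_eqF.
have zz0 : cabs (z - z0) = cabs z - cabs z0.
  rewrite {1}/z0 (_ : z - c%:C * z = (1 - c)%:C * z).
    rewrite cabsM cabs_real ger0_norm ?subr_ge0// mulrBl mul1r.
    by rewrite cabsM cabs_real ger0_norm.
  by rewrite rmorphB rmorph1 mulrBl mul1r.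
have z0rho : cabs z0 < rho by rewrite z0E; lra.
have [_ _ fz] := expn z0 z0rho.
have E : z = z0 + (z - z0) by ring.
rewrite [in LHS]E fz; last by rewrite zz0 z0E; lra.
rewrite -(ps_recenter ar'); last by rewrite zz0 z0E; lra.
by rewrite -E.
Qed.

(** The supremum of the radii up to which one series represents [f] is attained, and
[extend_expansion] excludes that it is less than 1. *)
Theorem analytic_power_series f : analytic_on (@unit_disc R) f ->
  exists a, pconv a 1 /\ forall z, cabs z < 1 -> f z = ps a z.
Proof.
move=> fa; have [a [e [e0 ae fe]]] : exists a e, [/\ 0 < e, pconv a e &
    forall z, cabs z < e -> f z = ps a z].
  have [|a [e [e0 ae fe]]] := @analytic_expansion f 0 fa; first by rewrite cabs0.
  by exists a, e; split => // z /fe; rewrite add0r.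
pose S := [set s : R | [/\ s <= 1, pconv a s & forall z, cabs z < s -> f z = ps a z]].
have Se : S (Num.min e 1).
  split; first by rewrite ge_min lexx orbT.
    by apply: pconvW ae _; rewrite ge_min lexx.
  by move=> z; rewrite lt_min => /andP[/fe].
have hS : has_sup S by split; [exists (Num.min e 1)|exists 1 => s []].
pose rho := sup S.
have rho1 : rho <= 1 by apply: ge_sup; [case: hS|move=> s []].
have near_sup t : t < rho -> exists2 s, S s & t < s.
  move=> trho; have e1 : 0 < rho - t by rewrite subr_gt0.
  by have [s Ss] := sup_adherent e1 hS; rewrite subKr; exists s.
have arho : pconv a rho.
  by move=> t t0 /near_sup[s [_ as_ _] ts]; exact: as_.
have frho z : cabs z < rho -> f z = ps a z.
  by move=> /near_sup[s [_ _ fs] /fs].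
have rho0 : 0 < rho.
  apply: (@lt_le_trans _ _ (Num.min e 1)); first by rewrite lt_min e0 ltr01.
  by apply: ub_le_sup => //; case: hS.
have [rho_lt1|rho_ge1] := ltP rho 1; last first.
  exists a; split; first exact: pconvW arho _.
  by move=> z z1; apply: frho; lra.
have [rho' [lt' a' f']] := extend_expansion fa rho0 rho_lt1 arho frho.
exfalso; suff : Num.min rho' 1 <= rho.
  by rewrite leNgt lt_min lt' rho_lt1.
apply: ub_le_sup; first by case: hS.
split; first by rewrite ge_min lexx orbT.
  by apply: pconvW a' _; rewrite ge_min lexx.
by move=> z; rewrite lt_min => /andP[/f'].
Qed.

End LocalToGlobal.

(** * Integrals of power series along segments *)

Section SegmentIntegral.
Context {R : realType}.
Implicit Types (a c : nat -> R[i]) (z w h : R[i]) (g : R[i] -> R[i]).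

Lemma is_derive_quadratic (f : R -> R) (t D K d : R) : 0 < d -> 0 <= K ->
  (forall k, `|k| <= d -> `|f (t + k) - f t - D * k| <= K * k ^+ 2) ->
  is_derive t 1 f D.
Proof.
move=> d0 K0 hK.
have cv : (fun h : R => h^-1 *: ((f \o shift t) (h *: (1 : R^o)) - f t)) @ 0^' --> D.
  apply/cvgrPdist_lt => e e0.
  have K1 : 0 < K + 1 by lra.
  have m0 : 0 < Num.min d (e / (K + 1)) by rewrite lt_min d0 divr_gt0.
  near=> h.
  have h0 : h != 0 by near: h; exact: nbhs_dnbhs_neq.
  have hm : `|h| < Num.min d (e / (K + 1)) by near: h; exact: dnbhs0_lt.
  move: hm; rewrite lt_min => /andP[hd he].
  have hn0 : 0 < `|h| by rewrite normr_gt0.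
  rewrite /= -[h%:A]/(h * 1) mulr1 [h + t]addrC -[_ *: _]/(h^-1 * (f (t + h) - f t)).
  have -> : D - h^-1 * (f (t + h) - f t) = - (h^-1 * (f (t + h) - f t - D * h)).
    by field.
  rewrite normrN normrM normfV ltr_pdivrMl//.
  apply: le_lt_trans (hK _ (ltW hd)) _.
  rewrite -(real_normK (num_real h)).
  rewrite expr2 mulrA [ltRHS]mulrC ltr_pM2r//.
  move: he; rewrite ltr_pdivlMr// => he; apply: le_lt_trans he.
  by rewrite mulrC ler_wpM2l// lerDl.
apply: DeriveDef; first by apply/cvg_ex; exists D.
by apply/cvg_lim.
Unshelve. all: by end_near. Qed.

(** The increment [k] of the parameter moves the point by [k z]. *)
Lemma is_derive_ps_ray a r z (t : R) : pconv a r -> cabs (t%:C * z) < r ->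
  let D := ps (dcoef a 1) (t%:C * z) * z in
  is_derive t 1 (fun s : R => complex.Re (ps a (s%:C * z))) (complex.Re D) /\
  is_derive t 1 (fun s : R => complex.Im (ps a (s%:C * z))) (complex.Im D).
Proof.
move=> ar tr D; have [K [d [K0 d0 hK]]] := ps_quadratic ar tr.
have z0 := cabs_ge0 z.
have zp : 0 < cabs z + 1 by lra.
have main (k : R) : `|k| <= d / (cabs z + 1) ->
    cabs (ps a ((t + k)%:C * z) - ps a (t%:C * z) - D * k%:C) <=
    K * cabs z ^+ 2 * k ^+ 2.
  rewrite ler_pdivlMr// => kd.
  have ckz : cabs (k%:C * z) <= d.
    rewrite cabsM cabs_real; apply: le_trans kd.
    by rewrite ler_wpM2l// lerDl.
  have := hK _ ckz; rewrite rmorphD mulrDl cabsM cabs_real exprMn real_normK ?num_real//.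
  by rewrite (_ : D * k%:C = ps (dcoef a 1) (t%:C * z) * (k%:C * z)) ?[k ^+ 2 * _]mulrC ?mulrA// /D; ring.
have K' : 0 <= K * cabs z ^+ 2 by rewrite mulr_ge0 ?exprn_ge0.
have d' : 0 < d / (cabs z + 1) by rewrite divr_gt0.
have ReMr (x : R[i]) (k : R) : complex.Re (x * k%:C) = complex.Re x * k.
  by case: x => p q /=; rewrite mulr0 subr0.
have ImMr (x : R[i]) (k : R) : complex.Im (x * k%:C) = complex.Im x * k.
  by case: x => p q /=; rewrite mulr0 add0r.
split; apply: (is_derive_quadratic d' K') => k /main; apply: le_trans.
  by rewrite -ReMr -!ReB; exact: cabs_Re.
by rewrite -ImMr -!ImB; exact: cabs_Im.
Qed.

(** The coefficients of the primitive vanishing at 0. *)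
Definition icoef c n : R[i] := if n is n'.+1 then c n' / n'.+1%:R else 0.

Lemma dcoef_icoef c : dcoef (icoef c) 1 = c.
Proof.
apply/funext => n; rewrite /dcoef addn1 /= binSn.
by rewrite mulrCA divff ?mulr1// pnatr_eq0.
Qed.

Lemma pconv_icoef c r : pconv c r -> pconv (icoef c) r.
Proof.
move=> cr s s0 sr; have [B cB] := cr s s0 sr; exists (s * B) => -[|N].
  by rewrite big_ord0 mulr_ge0//; have := cB 0%N; rewrite big_ord0.
rewrite big_ord_recl /= cabs0 mul0r add0r.
apply: le_trans (ler_wpM2l s0 (cB N)); rewrite mulr_sumr; apply: ler_sum => i _.
rewrite /bump /= add1n cabsM cabsV cabs_nat exprS mulrCA ler_wpM2l//.
rewrite ler_wpM2r ?exprn_ge0// ler_pdivrMr// ler_peMr ?cabs_ge0//.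
by rewrite ler1n.
Qed.

Lemma Rintegral_derive (f F : R -> R) :
  (forall t : R, 0 <= t <= 1 -> is_derive t 1 F (f t)) ->
  (forall t : R, 0 <= t <= 1 -> derivable f t 1) ->
  \int[@lebesgue_measure R]_(t in `[0, 1]) f t = F 1 - F 0.
Proof.
move=> dF df; have F_cont (t : R) : 0 <= t <= 1 -> {for t, continuous F}.
  by move=> /dF ?; apply/differentiable_continuous/derivable1_diffP.
rewrite /Rintegral (@continuous_FTC2 R f F 0 1)//.
- apply: derivable_within_continuous => t; rewrite in_itv /=; exact: df.
- split.
  + move=> t; rewrite in_itv /= => /andP[t0 t1].
    by have := dF t; rewrite (ltW t0) (ltW t1) => /(_ isT) [].
  + by apply: cvg_at_right_filter; apply: F_cont; rewrite lexx ler01.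
  + by apply: cvg_at_left_filter; apply: F_cont; rewrite lexx ler01.
- move=> t; rewrite in_itv /= => /andP[t0 t1].
  have := dF t; rewrite (ltW t0) (ltW t1) => /(_ isT) [_ <-].
  by rewrite derive1E.
Qed.

(** Fundamental theorem of calculus for the primitive restricted to the ray
through [z]. *)
Lemma segment_integral_ps c g z : pconv c 1 -> cabs z < 1 ->
  (forall w, cabs w < 1 -> g w = ps c w) ->
  segment_integral g z = ps (icoef c) z.
Proof.
move=> c1 z1 gE; have ic1 := pconv_icoef c1.
have tz (t : R) : 0 <= t <= 1 -> cabs (t%:C * z) < 1.
  move=> /andP[t0 t1]; rewrite cabsM cabs_real ger0_norm//.
  by apply: le_lt_trans z1; rewrite ler_piMl ?cabs_ge0.
have dI (t : R) : 0 <= t <= 1 -> _ := fun t01 => is_derive_ps_ray ic1 (tz t t01).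
rewrite dcoef_icoef in dI.
have dc (t : R) : 0 <= t <= 1 -> _ := fun t01 => is_derive_ps_ray c1 (tz t t01).
have i0 : ps (icoef c) 0 = 0 by rewrite ps_at0.
rewrite /segment_integral /=.
have -> : \int[@lebesgue_measure R]_(t in `[0, 1]) complex.Re (g (t%:C * z) * z) =
          complex.Re (ps (icoef c) z).
  transitivity (\int[@lebesgue_measure R]_(t in `[0, 1])
      complex.Re (ps c (t%:C * z) * z)).
    by apply: eq_Rintegral => t; rewrite inE /= in_itv /= => /tz /gE ->.
  have df (t : R) : 0 <= t <= 1 ->
      derivable (fun s : R => complex.Re (ps c (s%:C * z) * z)) t 1.
    move=> /dc [? ?]; under eq_fun do rewrite ReM.
    by apply: derivableB; apply: derivableM.
  have := @Rintegral_derive _ _ (fun t t01 => proj1 (dI t t01)) df.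
  by move=> ->; rewrite rmorph1 mul1r rmorph0 mul0r i0 subr0.
have -> : \int[@lebesgue_measure R]_(t in `[0, 1]) complex.Im (g (t%:C * z) * z) =
          complex.Im (ps (icoef c) z).
  transitivity (\int[@lebesgue_measure R]_(t in `[0, 1])
      complex.Im (ps c (t%:C * z) * z)).
    by apply: eq_Rintegral => t; rewrite inE /= in_itv /= => /tz /gE ->.
  have df (t : R) : 0 <= t <= 1 ->
      derivable (fun s : R => complex.Im (ps c (s%:C * z) * z)) t 1.
    move=> /dc [? ?]; under eq_fun do rewrite ImM.
    by apply: derivableD; apply: derivableM.
  have := @Rintegral_derive _ _ (fun t t01 => proj2 (dI t t01)) df.
  by move=> ->; rewrite rmorph1 mul1r rmorph0 mul0r i0 subr0.
by case: (ps _ z).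
Qed.

End SegmentIntegral.

(** * Integration against a complex measure on the circle *)

Section ChargeIntegral.
Context {R : realType}.
Local Notation T := (borel_circle R).
Implicit Types (f g : T -> R) (nu : {charge set T -> \bar R}).

Definition bounded_measurable f :=
  measurable_fun setT f /\ exists M, forall x, `|f x| <= M.

Lemma bounded_measurable_integrable (mu : {finite_measure set T -> \bar R}) f :
  bounded_measurable f -> mu.-integrable setT (EFin \o f).
Proof.
move=> [mf [M fM]]; apply: measurable_bounded_integrable => //.
  by rewrite ltey_eq fin_num_measure.
exists M; split; first exact: num_real.
by move=> M' /ltW MM' x _ /=; exact: le_trans (fM x) MM'.
Qed.

Lemma bounded_measurable_cst (c : R) : bounded_measurable (fun=> c).
Proof. by split; [exact: measurable_cst|exists `|c|]. Qed.

Lemma bounded_measurableD f g : bounded_measurable f -> bounded_measurable g ->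
  bounded_measurable (fun x => f x + g x).
Proof.
move=> [mf [M fM]] [mg [N gN]]; split; first exact: measurable_funD.
by exists (M + N) => x; rewrite (le_trans (ler_normD _ _))// lerD.
Qed.

Lemma bounded_measurableM f g : bounded_measurable f -> bounded_measurable g ->
  bounded_measurable (fun x => f x * g x).
Proof.
move=> [mf [M fM]] [mg [N gN]]; split; first exact: measurable_funM.
by exists (M * N) => x; rewrite normrM ler_pM.
Qed.

Lemma bounded_measurableZ (c : R) f :
  bounded_measurable f -> bounded_measurable (fun x => c * f x).
Proof. by move=> bf; apply: bounded_measurableM => //; exact: bounded_measurable_cst. Qed.

Lemma bounded_measurableB f g : bounded_measurable f -> bounded_measurable g ->
  bounded_measurable (fun x => f x - g x).
Proof.
move=> bf /(bounded_measurableZ (-1)) bg.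
by under eq_fun do rewrite -mulN1r; exact: bounded_measurableD.
Qed.

Lemma bounded_measurable_indic (E : set T) : measurable E ->
  bounded_measurable (\1_E).
Proof.
move=> mE; split; first exact: measurable_indic.
by exists 1 => x; rewrite indicE; case: (x \in E); rewrite ?normr1 ?normr0.
Qed.

(** The total variation of a real charge, from its Jordan decomposition. *)
Definition charge_mass nu : R :=
  fine (jordan_pos (hahn_sets nu) setT) + fine (jordan_neg (hahn_sets nu) setT).

Lemma charge_mass_ge0 nu : 0 <= charge_mass nu.
Proof. by rewrite addr_ge0// fine_ge0. Qed.

Lemma charge_integralD nu f g : bounded_measurable f -> bounded_measurable g ->
  charge_integral nu (fun x => f x + g x) =
  charge_integral nu f + charge_integral nu g.
Proof.
move=> bf bg; rewrite /charge_integral !RintegralD//;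
  try exact: bounded_measurable_integrable.
by ring.
Qed.

Lemma charge_integralZ nu c f : bounded_measurable f ->
  charge_integral nu (fun x => c * f x) = c * charge_integral nu f.
Proof.
move=> bf; rewrite /charge_integral !RintegralZl//;
  try exact: bounded_measurable_integrable.
by ring.
Qed.

Lemma charge_integral_indic nu (E : set T) : measurable E ->
  charge_integral nu (\1_E) = fine (nu E).
Proof.
move=> mE; rewrite /charge_integral /Rintegral !integral_indic// !setIT.
rewrite (jordan_decomp (hahn_sets nu) mE) /cadd /= cscaleN1.
by rewrite fineD ?fineN// ?fin_numN fin_num_measure.
Qed.

Lemma Rintegral_le_bound (mu : {finite_measure set T -> \bar R}) f M :
  bounded_measurable f -> (forall x, `|f x| <= M) ->
  `|\int[mu]_x f x| <= M * fine (mu setT).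
Proof.
move=> bf fM; have bi := bounded_measurable_integrable mu bf.
apply: le_trans (le_normr_Rintegral _ bi) _ => //.
rewrite -Rintegral_cst//; apply: le_Rintegral => //.
  apply: bounded_measurable_integrable; split.
    by apply: measurableT_comp => //; case: bf.
  by exists M => x; rewrite normr_id.
by apply: bounded_measurable_integrable; exact: bounded_measurable_cst.
Qed.

Lemma charge_integral_le nu f M : bounded_measurable f ->
  (forall x, `|f x| <= M) -> `|charge_integral nu f| <= charge_mass nu * M.
Proof.
move=> bf fM; rewrite /charge_integral (le_trans (ler_normB _ _))//.
by rewrite mulrC /charge_mass mulrDr lerD// Rintegral_le_bound.
Qed.

End ChargeIntegral.

Section ComplexMeasureIntegral.
Context {R : realType}.
Local Notation T := (borel_circle R).
Implicit Types (f g : T -> R[i]) (mu : complex_measure R) (c : R[i]).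

Definition cbounded_measurable g :=
  bounded_measurable (fun x => complex.Re (g x)) /\
  bounded_measurable (fun x => complex.Im (g x)).

Lemma cbounded_measurable_cst c : cbounded_measurable (fun=> c).
Proof. by split; exact: bounded_measurable_cst. Qed.

Lemma cbounded_measurableD f g : cbounded_measurable f -> cbounded_measurable g ->
  cbounded_measurable (fun x => f x + g x).
Proof.
move=> [f1 f2] [g1 g2]; split.
  by under eq_fun do rewrite ReD; exact: bounded_measurableD.
by under eq_fun do rewrite ImD; exact: bounded_measurableD.
Qed.

Lemma cbounded_measurableM f g : cbounded_measurable f -> cbounded_measurable g ->
  cbounded_measurable (fun x => f x * g x).
Proof.
move=> [f1 f2] [g1 g2]; split.
  by under eq_fun do rewrite ReM; apply: bounded_measurableB; exact: bounded_measurableM.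
by under eq_fun do rewrite ImM; apply: bounded_measurableD; exact: bounded_measurableM.
Qed.

Lemma cbounded_measurableZ c f :
  cbounded_measurable f -> cbounded_measurable (fun x => c * f x).
Proof. by apply: cbounded_measurableM; exact: cbounded_measurable_cst. Qed.

Lemma cbounded_measurableX f n :
  cbounded_measurable f -> cbounded_measurable (fun x => f x ^+ n).
Proof.
move=> bf; elim: n => [|n IH].
  by under eq_fun do rewrite expr0; exact: cbounded_measurable_cst.
by under eq_fun do rewrite exprS; exact: cbounded_measurableM.
Qed.

Lemma cbounded_measurable_sum (F : nat -> T -> R[i]) N :
  (forall n, cbounded_measurable (F n)) ->
  cbounded_measurable (fun x => \sum_(n < N) F n x).
Proof.
move=> bF; elim: N => [|N IH].
  by under eq_fun do rewrite big_ord0; exact: cbounded_measurable_cst.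
by under eq_fun do rewrite big_ord_recr; exact: cbounded_measurableD.
Qed.

Lemma cbounded_measurable_indic (E : set T) : measurable E ->
  cbounded_measurable (fun x => (\1_E x)%:C).
Proof.
by move=> mE; split; [exact: bounded_measurable_indic|exact: bounded_measurable_cst].
Qed.

Lemma cmeasure_integralD mu f g : cbounded_measurable f -> cbounded_measurable g ->
  cmeasure_integral mu (fun x => f x + g x) =
  cmeasure_integral mu f + cmeasure_integral mu g.
Proof.
move=> [f1 f2] [g1 g2]; rewrite /cmeasure_integral.
under [X in charge_integral (re_part mu) X - _]eq_fun do rewrite ReD.
under [X in _ - charge_integral _ X]eq_fun do rewrite ImD.
under [X in charge_integral (re_part mu) X + _]eq_fun do rewrite ImD.
under [X in _ + charge_integral (im_part mu) X]eq_fun do rewrite ReD.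
rewrite !(charge_integralD _ f1 g1) !(charge_integralD _ f2 g2).
have E (p q r s p' q' r' s' : R) :
    ((p + q) - (r + s)) +i* ((p' + q') + (r' + s')) =
    ((p - r) +i* (p' + r')) + ((q - s) +i* (q' + s')).
  by congr (_ +i* _); ring.
exact: E.
Qed.

Lemma cmeasure_integralZ mu c f : cbounded_measurable f ->
  cmeasure_integral mu (fun x => c * f x) = c * cmeasure_integral mu f.
Proof.
move=> [f1 f2]; rewrite /cmeasure_integral.
under [X in charge_integral (re_part mu) X - _]eq_fun do rewrite ReM -mulNr.
under [X in _ - charge_integral _ X]eq_fun do rewrite ImM.
under [X in charge_integral (re_part mu) X + _]eq_fun do rewrite ImM.
under [X in _ + charge_integral (im_part mu) X]eq_fun do rewrite ReM -mulNr.
rewrite !(charge_integralD _ (bounded_measurableZ _ f1) (bounded_measurableZ _ f2)).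
rewrite !(charge_integralD _ (bounded_measurableZ _ f2) (bounded_measurableZ _ f1)).
rewrite !(charge_integralZ _ _ f1) !(charge_integralZ _ _ f2).
have E (p q u v w x : R) :
    ((p * u + - q * v) - (p * w + q * x)) +i* ((p * v + q * u) + (p * x + - q * w)) =
    (p +i* q) * ((u - w) +i* (v + x)) :> R[i].
  by congr (_ +i* _); ring.
by case: c => p q; exact: E.
Qed.

Lemma cmeasure_integral_sum mu (F : nat -> T -> R[i]) N :
  (forall n, cbounded_measurable (F n)) ->
  cmeasure_integral mu (fun x => \sum_(n < N) F n x) =
  \sum_(n < N) cmeasure_integral mu (F n).
Proof.
move=> bF; elim: N => [|N IH].
  rewrite big_ord0; under eq_fun do rewrite big_ord0 -[0](mul0r (0 : R[i])).
  by rewrite cmeasure_integralZ ?mul0r//; exact: cbounded_measurable_cst.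
under eq_fun do rewrite big_ord_recr.
rewrite cmeasure_integralD ?IH ?big_ord_recr//.
exact: cbounded_measurable_sum.
Qed.

Lemma cmeasure_integral_indic mu (E : set T) : measurable E ->
  cmeasure_integral mu (fun x => (\1_E x)%:C) = cmeasure mu E.
Proof.
move=> mE; rewrite /cmeasure_integral /cmeasure /= !charge_integral_indic//.
have c0 nu : charge_integral nu (fun _ : T => 0) = 0.
  have E0 : (fun _ : T => 0 : R) = (fun _ => 0 * 0) by apply/funext => x; rewrite mul0r.
  by rewrite E0 (charge_integralZ nu 0 (bounded_measurable_cst 0)) mul0r.
by rewrite !c0 subr0 add0r.
Qed.

(** Comes from the real and imaginary parts separately; it is at least the variation
and suffices for error terms. *)
Definition cmeasure_mass mu : R :=
  2 * (charge_mass (re_part mu) + charge_mass (im_part mu)).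

Lemma cmeasure_mass_ge0 mu : 0 <= cmeasure_mass mu.
Proof. by rewrite mulr_ge0// addr_ge0 ?charge_mass_ge0. Qed.

Lemma cmeasure_integral_le_mass mu g M : cbounded_measurable g ->
  (forall x, cabs (g x) <= M) -> cabs (cmeasure_integral mu g) <= cmeasure_mass mu * M.
Proof.
move=> [g1 g2] gM.
have re x : `|complex.Re (g x)| <= M by exact: le_trans (cabs_Re _) (gM x).
have im x : `|complex.Im (g x)| <= M by exact: le_trans (cabs_Im _) (gM x).
rewrite (le_trans (cabs_le_ReIm _))//= /cmeasure_mass.
have h1 := charge_integral_le (re_part mu) g1 re.
have h2 := charge_integral_le (im_part mu) g1 re.
have h3 := charge_integral_le (re_part mu) g2 im.
have h4 := charge_integral_le (im_part mu) g2 im.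
apply: le_trans (lerD (ler_normB _ _) (ler_normD _ _)) _.
have aux (a b c d p q : R) : a <= p * M -> b <= q * M -> c <= p * M -> d <= q * M ->
    a + b + (c + d) <= 2 * (p + q) * M by clear; move=> *; lra.
exact: aux.
Qed.

End ComplexMeasureIntegral.

Section Variation.
Context {R : realType}.
Local Notation T := (borel_circle R).
Implicit Types (g : T -> R[i]) (mu : complex_measure R).

(** A finite part of a countable partition is bounded by the defining supremum. *)
Lemma variation_partial_sum mu (v : R) (F : nat -> set T) N :
  (cmeasure_variation mu <= v%:E)%E -> (forall n, measurable (F n)) ->
  trivIset setT F -> \bigcup_n F n = setT ->
  \sum_(n < N) cabs (cmeasure mu (F n)) <= v.
Proof.
move=> muv mF tF cF; rewrite -lee_fin; apply: le_trans muv.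
have : ((\sum_(0 <= n <oo) (cabs (cmeasure mu (F n)))%:E) <= cmeasure_variation mu)%E.
  by apply: ereal_sup_ubound; exists F.
apply: le_trans; rewrite -sumEFin -(big_mkord xpredT (fun n => (cabs (cmeasure mu (F n)))%:E)).
by apply: nneseries_lim_ge => n _ _; rewrite lee_fin cabs_ge0.
Qed.

(** The cells are the inverse images of the squares of a grid in the plane; each
nonempty cell carries a value of [g] taken in it, which keeps the bound [M]. *)
Lemma simple_approximation g M e : cbounded_measurable g ->
  (forall x, cabs (g x) <= M) -> 0 < e ->
  exists (F : nat -> set T) (c : nat -> R[i]) N,
  [/\ forall n, measurable (F n), trivIset setT F, \bigcup_n F n = setT,
      forall n, cabs (c n) <= M &
      forall x, cabs (g x - \sum_(n < N) c n * (\1_(F n) x)%:C) <= e].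
Proof.
move=> [[mg1 _] [mg2 _]] gM e0.
have M0 : 0 <= M by exact: le_trans (cabs_ge0 _) (gM point).
pose d := e / 2; have d0 : 0 < d by rewrite divr_gt0.
pose ix (f : T -> R) x : nat := Num.truncn ((f x + M) / d).
have rng (f : T -> R) x : `|f x| <= M -> 0 <= (f x + M) / d.
  by move=> h; rewrite divr_ge0 ?(ltW d0)// -lerBlDr sub0r; move: h; rewrite ler_norml => /andP[].
have mix (f : T -> R) k : measurable_fun setT f -> (forall x, `|f x| <= M) ->
    measurable [set x | ix f x = k].
  move=> mf fM.
  rewrite (_ : [set x | ix f x = k] = setT `&` f @^-1` `[k%:R * d - M, k.+1%:R * d - M[).
    by apply: mf => //; exact: measurable_itv.
  rewrite setTI; apply/seteqP; split => x /=.
    move=> /eqP; rewrite truncn_eq ?rng// => /andP[h1 h2].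
    rewrite in_itv /= lerBlDr ltrBrDr.
    by rewrite -ler_pdivlMr// -ltr_pdivrMr// h1 h2.
  rewrite in_itv /= lerBlDr ltrBrDr -ler_pdivlMr// -ltr_pdivrMr// => h.
  by apply/eqP; rewrite truncn_eq ?rng.
pose K := (Num.truncn ((M + M) / d)).+1.
have ixK (f : T -> R) x : `|f x| <= M -> (ix f x < K)%N.
  move=> h; rewrite ltnS; apply: le_truncn; rewrite ler_wpM2r ?invr_ge0 ?(ltW d0)//.
  by rewrite lerD2r; apply: le_trans h; exact: ler_norm.
pose g1 x := complex.Re (g x); pose g2 x := complex.Im (g x).
have g1M x : `|g1 x| <= M by exact: le_trans (cabs_Re _) (gM x).
have g2M x : `|g2 x| <= M by exact: le_trans (cabs_Im _) (gM x).
pose F n := [set x | ix g1 x = (n %/ K)%N] `&` [set x | ix g2 x = (n %% K)%N].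
(* A cell of the two-dimensional grid is numbered by one natural number through
   division by [K], which exceeds both indices. *)
pose code x := (ix g1 x * K + ix g2 x)%N.
have F_code x : F (code x) x.
  by split => /=; rewrite /code ?divnMDl// ?modnMDl ?(divn_small (ixK _ _ (g2M x))) ?addn0// modn_small// ixK.
have code_F n x : F n x -> code x = n.
  by move=> [/= h1 h2]; rewrite /code h1 h2 -divn_eq.
pose c n := if pselect (exists x, F n x) is left h then g (projT1 (cid h)) else 0.
exists F, c, (K * K)%N; split.
- by move=> n; apply: measurableI; apply: mix.
- by move=> m n _ _ [x [/code_F <- /code_F <-]].
- by apply/seteqP; split => // x _; exists (code x).
- by move=> n; rewrite /c; case: pselect => [h|_]; rewrite ?cabs0.
move=> x.
have codeK : (code x < K * K)%N.
  have := ixK _ _ (g1M x); have := ixK _ _ (g2M x); rewrite /code; nia.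
rewrite (bigD1 (Ordinal codeK)) //= big1 ?addr0; last first.
  move=> n nx; rewrite indicE memNset ?mulr0// => /code_F h.
  by move/eqP: nx; apply; apply: val_inj => /=.
rewrite indicE mem_set// mulr1 /c; case: pselect => [h|]; last by case; exists x.
case: (cid h) => y /= [/= y1 y2]; have [/= x1 x2] := F_code x.
have close (f : T -> R) : `|f x| <= M -> `|f y| <= M -> ix f x = ix f y -> `|f x - f y| <= d.
  move=> fx fy ixy; have := truncn_itv (rng _ _ fx); have := truncn_itv (rng _ _ fy).
  rewrite -/(ix f x) -/(ix f y) ixy => /andP[a1 a2] /andP[b1 b2].
  rewrite ler_pdivlMr// in a1; rewrite ler_pdivlMr// in b1.
  rewrite ltr_pdivrMr// -natr1 mulrDl mul1r in a2.
  rewrite ltr_pdivrMr// -natr1 mulrDl mul1r in b2.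
  rewrite ler_norml; move: a1 a2 b1 b2; move: (_ * d) => q.
  by clear; move=> *; apply/andP; split; lra.
rewrite (le_trans (cabs_le_ReIm _))// ReB ImB [leRHS](splitr e) lerD//.
  by apply: (close g1) => //; rewrite x1 y1.
by apply: (close g2) => //; rewrite x2 y2.
Qed.

(** On simple functions this is the triangle inequality and the definition of the
variation by partitions; the approximation error is absorbed by the crude
bound [cmeasure_integral_le_mass]. *)
Lemma cmeasure_integral_le_variation mu (v M : R) g :
  (cmeasure_variation mu <= v%:E)%E -> cbounded_measurable g ->
  (forall x, cabs (g x) <= M) -> cabs (cmeasure_integral mu g) <= v * M.
Proof.
move=> muv bg gM; apply/ler_addgt0Pr => e e0.
have M0 : 0 <= M by exact: le_trans (cabs_ge0 _) (gM point).
have m1 : 0 < cmeasure_mass mu + 1 by have := cmeasure_mass_ge0 mu; lra.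
have [F [c [N [mF tF cF cM gF]]]] :=
  simple_approximation bg gM (divr_gt0 e0 m1).
pose s x := \sum_(n < N) c n * (\1_(F n) x)%:C.
have bt n : cbounded_measurable (fun x => c n * (\1_(F n) x)%:C).
  by apply: cbounded_measurableZ; exact: cbounded_measurable_indic.
have bs : cbounded_measurable s := cbounded_measurable_sum N bt.
have bd : cbounded_measurable (fun x => g x - s x).
  under eq_fun do rewrite -mulN1r; apply: cbounded_measurableD => //.
  exact: cbounded_measurableZ.
have -> : cmeasure_integral mu g =
    cmeasure_integral mu s + cmeasure_integral mu (fun x => g x - s x).
  rewrite -cmeasure_integralD//; congr cmeasure_integral; apply/funext => x.
  by rewrite addrC subrK.
rewrite (le_trans (cabsD _ _))// lerD//.
  rewrite (cmeasure_integral_sum mu N bt).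
  apply: (@le_trans _ _ (\sum_(n < N) M * cabs (cmeasure mu (F n)))).
    rewrite (le_trans (cabs_sum _ _ _))//; apply: ler_sum => n _.
    rewrite cmeasure_integralZ ?cmeasure_integral_indic//; last exact: cbounded_measurable_indic.
    by rewrite cabsM ler_wpM2r ?cabs_ge0.
  by rewrite -mulr_sumr mulrC ler_wpM2r//; exact: variation_partial_sum.
apply: le_trans (cmeasure_integral_le_mass mu bd gF) _.
rewrite mulrA ler_pdivrMr// mulrC ler_wpM2l ?(ltW e0)//; lra.
Qed.

End Variation.

(** * Cauchy transforms and moments *)

Section Moments.
Context {R : realType}.
Local Notation T := (borel_circle R).
Implicit Types (mu : complex_measure R) (z w q : R[i]).

Definition circle_conj (x : T) : R[i] := (circle_val x)^*.

Lemma cabs_circle (x : T) : cabs (circle_val x) = 1.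
Proof.
have : `|circle_val x| = 1 by have := set_valP x.
by rewrite normC_cabs => -[].
Qed.

Lemma cabs_circle_conj x : cabs (circle_conj x) = 1.
Proof. by rewrite cabsJ cabs_circle. Qed.

Lemma open_Re_preimage (a : R) : open [set z : R[i] | a < complex.Re z].
Proof.
rewrite openE => z /= az; apply/nbhs_ballP.
exists (complex.Re z - a)%:C; first by rewrite /= ltcR subr_gt0.
move=> w; rewrite -ball_normE /= ltC_cabs => zw.
have := le_lt_trans (cabs_Re _) zw; rewrite ReB ltr_norml; lra.
Qed.

Lemma open_Im_preimage (a : R) : open [set z : R[i] | a < complex.Im z].
Proof.
rewrite openE => z /= az; apply/nbhs_ballP.
exists (complex.Im z - a)%:C; first by rewrite /= ltcR subr_gt0.
move=> w; rewrite -ball_normE /= ltC_cabs => zw.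
have := le_lt_trans (cabs_Im _) zw; rewrite ImB ltr_norml; lra.
Qed.

(** Rays generate the Borel sets of the line, and the sigma-algebra of the circle
is generated by traces of open sets of the plane. *)
Lemma measurable_circle (h : R[i] -> R) :
  (forall a : R, open [set z : R[i] | a < h z]) ->
  measurable_fun setT (fun x : T => h (circle_val x)).
Proof.
move=> hopen; apply: (measurability _ (RGenOInfty.measurableE R)).
move=> _ [_ [a ->] <-]; rewrite setTI.
apply: sub_sigma_algebra; exists [set z | a < h z]; first exact: hopen.
by apply/seteqP; split => x /=; rewrite in_itv /= andbT.
Qed.

Lemma circle_conj_bounded_measurable : cbounded_measurable circle_conj.
Proof.
split; split.
- rewrite (_ : (fun x => _) = fun x : T => complex.Re (circle_val x)).
    exact: measurable_circle open_Re_preimage.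
  by apply/funext => x; rewrite /circle_conj; case: circle_val.
- by exists 1 => x; rewrite -(cabs_circle_conj x) cabs_Re.
- rewrite (_ : (fun x => _) = fun x : T => - complex.Im (circle_val x)).
    apply: measurableT_comp => //; exact: measurable_circle open_Im_preimage.
  by apply/funext => x; rewrite /circle_conj; case: circle_val.
- by exists 1 => x; rewrite -(cabs_circle_conj x) cabs_Im.
Qed.

Definition moment mu m : R[i] :=
  cmeasure_integral mu (fun x => circle_conj x ^+ m).

Lemma circle_conjX_bounded_measurable m :
  cbounded_measurable (fun x => circle_conj x ^+ m).
Proof. exact: cbounded_measurableX circle_conj_bounded_measurable. Qed.

Lemma moment_le mu m : cabs (moment mu m) <= cmeasure_mass mu.
Proof.
rewrite -[leRHS]mulr1; apply: cmeasure_integral_le_mass.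
  exact: circle_conjX_bounded_measurable.
by move=> x; rewrite cabsX cabs_circle_conj expr1n.
Qed.

Lemma pconv_moment mu : pconv (moment mu) 1.
Proof.
apply: (@pconv_of_bounded _ _ _ (cmeasure_mass mu)) => m.
by rewrite expr1n mulr1 moment_le.
Qed.

Lemma geometric_remainder q N : cabs q < 1 ->
  cabs ((1 - q)^-1 - \sum_(m < N) q ^+ m) <= cabs q ^+ N / (1 - cabs q).
Proof.
move=> q1; have q1' : 1 - q != 0.
  rewrite subr_eq0; apply/eqP => /(congr1 (@cabs R)); rewrite cabs1; lra.
have -> : (1 - q)^-1 - \sum_(m < N) q ^+ m = q ^+ N * (1 - q)^-1.
  apply: (mulIf q1'); rewrite mulrBl mulVf// mulfVK//.
  have := subrX1 q N; set S := \sum_(i < N) q ^+ i; move=> h.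
  by rewrite (_ : S * (1 - q) = - ((q - 1) * S)); [rewrite -h; ring|ring].
rewrite cabsM cabsX cabsV ler_wpM2l ?exprn_ge0 ?cabs_ge0//.
rewrite lef_pV2 ?posrE ?cabs_gt0 ?subr_gt0//.
by have := cabs_distD 1 q 0; rewrite !subr0 cabs1; lra.
Qed.

Lemma geometric_remainder_cvg q : cabs q < 1 ->
  (fun N => cabs q ^+ N / (1 - cabs q)) @ \oo --> (0 : R).
Proof.
move=> q1; rewrite -[X in _ --> X](mul0r (1 - cabs q)^-1).
apply: cvgM; last exact: cvg_cst.
by apply: cvg_expr; rewrite ger0_norm ?cabs_ge0.
Qed.

Lemma cabs_kernel_arg z x : cabs (circle_conj x * z) = cabs z.
Proof. by rewrite cabsM cabs_circle_conj mul1r. Qed.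

(** The kernel is the uniform limit on the circle of its geometric partial sums,
which are polynomials in the conjugate coordinate. *)
Lemma cauchy_kernel_bounded_measurable z : cabs z < 1 ->
  cbounded_measurable (fun x : T => (1 - circle_conj x * z)^-1).
Proof.
move=> z1; pose S N (x : T) := \sum_(m < N) (circle_conj x * z) ^+ m.
have bS N : cbounded_measurable (S N).
  apply: (cbounded_measurable_sum (F := fun m x => (circle_conj x * z) ^+ m)) => m.
  apply: cbounded_measurableX; under eq_fun do rewrite mulrC.
  exact: cbounded_measurableZ circle_conj_bounded_measurable.
have rem x N : cabs ((1 - circle_conj x * z)^-1 - S N x) <=
    cabs z ^+ N / (1 - cabs z).
  rewrite -(cabs_kernel_arg z x); apply: geometric_remainder.
  by rewrite cabs_kernel_arg.
have bd x : cabs (1 - circle_conj x * z)^-1 <= (1 - cabs z)^-1.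
  by have := rem x 0%N; rewrite /S big_ord0 subr0 expr0 mul1r.
have cv (h : R[i] -> R) : (forall u v, `|h u - h v| <= cabs (u - v)) ->
    forall x, (fun N => h (S N x)) @ \oo --> h (1 - circle_conj x * z)^-1.
  move=> hh x; apply/cvgrPdist_lt => e e0.
  have /cvgrPdist_lt /(_ e e0) := geometric_remainder_cvg z1.
  apply: filterS => N; rewrite sub0r normrN => lt.
  apply: le_lt_trans (hh _ _) _; apply: le_lt_trans (rem x N) _.
  exact: le_lt_trans (ler_norm _) lt.
split; split.
- apply: (measurable_fun_cvg (h := fun N x => complex.Re (S N x))).
    by move=> N; case: (bS N) => -[].
  by move=> x _; apply: cv => u v; rewrite -ReB cabs_Re.
- by exists (1 - cabs z)^-1 => x; apply: le_trans (cabs_Re _) (bd x).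
- apply: (measurable_fun_cvg (h := fun N x => complex.Im (S N x))).
    by move=> N; case: (bS N) => _ [].
  by move=> x _; apply: cv => u v; rewrite -ImB cabs_Im.
- by exists (1 - cabs z)^-1 => x; apply: le_trans (cabs_Im _) (bd x).
Qed.

(** The geometric series of the kernel converges uniformly on the circle, so it can
be integrated term by term. *)
Lemma cauchy_transform_ps mu z : cabs z < 1 ->
  cauchy_transform mu z = ps (moment mu) z.
Proof.
move=> z1; apply/esym/csum_eq; apply/cvg_cabsP => e e0.
pose C := cmeasure_mass mu + 1.
have C0 : 0 < C by have := cmeasure_mass_ge0 mu; rewrite /C; lra.
have /cvgrPdist_lt /(_ _ (divr_gt0 e0 C0)) := geometric_remainder_cvg z1.
apply: filterS => N; rewrite sub0r normrN series_ord.
set rN := cabs z ^+ N / _ => lt.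
have rN0 : 0 <= rN by rewrite divr_ge0 ?exprn_ge0 ?cabs_ge0// subr_ge0 ltW.
have bt m : cbounded_measurable (fun x => z ^+ m * circle_conj x ^+ m).
  exact: cbounded_measurableZ (circle_conjX_bounded_measurable m).
have bk := cauchy_kernel_bounded_measurable z1.
pose S x := \sum_(m < N) z ^+ m * circle_conj x ^+ m.
have bS : cbounded_measurable S := cbounded_measurable_sum N bt.
have -> : \sum_(m < N) moment mu m * z ^+ m = cmeasure_integral mu S.
  rewrite (cmeasure_integral_sum mu N bt); apply: eq_bigr => m _.
  by rewrite (cmeasure_integralZ mu _ (circle_conjX_bounded_measurable m)) mulrC.
have -> : cauchy_transform mu z = cmeasure_integral mu S +
    cmeasure_integral mu (fun x => (1 - circle_conj x * z)^-1 + -1 * S x).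
  rewrite (cmeasure_integralD mu bk (cbounded_measurableZ (-1) bS)).
  by rewrite (cmeasure_integralZ mu (-1) bS) mulN1r addrC subrK.
rewrite cabsB addrAC subrr add0r.
apply: (@le_lt_trans _ _ (C * rN)); last first.
  by rewrite mulrC -ltr_pdivlMr//; exact: le_lt_trans (ler_norm _) lt.
apply: (@le_trans _ _ (cmeasure_mass mu * rN)); last first.
  by rewrite ler_wpM2r// /C lerDl.
apply: cmeasure_integral_le_mass.
  exact: cbounded_measurableD bk (cbounded_measurableZ (-1) bS).
move=> x; rewrite mulN1r /rN -(cabs_kernel_arg z x).
rewrite (_ : S x = \sum_(m < N) (circle_conj x * z) ^+ m).
  by apply: geometric_remainder; rewrite cabs_kernel_arg.
by apply: eq_bigr => m _; rewrite exprMn mulrC.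
Qed.

(** The left-hand sum is the integral of the conjugate of the polynomial. *)
Lemma moment_pairing_le mu (v M : R) (b : nat -> R[i]) N :
  (cmeasure_variation mu <= v%:E)%E ->
  (forall w, cabs w = 1 -> cabs (\sum_(m < N) b m * w ^+ m) <= M) ->
  cabs (\sum_(m < N) (b m)^* * moment mu m) <= v * M.
Proof.
move=> muv bM.
have bt m : cbounded_measurable (fun x => (b m)^* * circle_conj x ^+ m).
  exact: cbounded_measurableZ (circle_conjX_bounded_measurable m).
have -> : \sum_(m < N) (b m)^* * moment mu m =
    cmeasure_integral mu (fun x => \sum_(m < N) (b m)^* * circle_conj x ^+ m).
  rewrite (cmeasure_integral_sum mu N bt); apply: eq_bigr => m _.
  by rewrite (cmeasure_integralZ mu _ (circle_conjX_bounded_measurable m)).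
apply: cmeasure_integral_le_variation => //.
  exact: cbounded_measurable_sum N bt.
move=> x; rewrite -cabsJ rmorph_sum /=.
rewrite (eq_bigr (fun m : 'I_N => b m * circle_val x ^+ m)); last first.
  by move=> m _; rewrite rmorphM rmorphXn /= !conjcK.
by apply: bM; exact: cabs_circle.
Qed.

End Moments.

(** * The equation and its kernel in coefficients *)

Section ConjugateSeries.
Context {R : realType}.

Lemma csum_conj (x : nat -> R[i]) B : abs_summable x B ->
  csum (fun n => (x n)^*) = (csum x)^*.
Proof.
move=> /abs_summable_cvg_ord /cvg_cabsP h; apply: csum_eq; apply/cvg_cabsP => e e0.
have := h e e0; apply: filterS => n; rewrite series_ord.
rewrite (_ : \sum_(i < n) (x i)^* = (\sum_(i < n) x i)^*); last by rewrite rmorph_sum.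
by rewrite -rmorphB cabsJ.
Qed.

Lemma pconv_conj (a : nat -> R[i]) r : pconv a r -> pconv (fun n => (a n)^*) r.
Proof.
move=> ar s s0 sr; have [B aB] := ar s s0 sr; exists B => N.
by under eq_bigr do rewrite cabsJ.
Qed.

End ConjugateSeries.

Section Equation.
Context {R : realType}.
Implicit Types (a b : nat -> R[i]) (f g A : R[i] -> R[i]) (z w : R[i]).

Lemma derive1_ps g a z : pconv a 1 -> (forall w, cabs w < 1 -> g w = ps a w) ->
  cabs z < 1 -> derive1 g z = ps (dcoef a 1) z.
Proof.
move=> a1 gE z1.
apply: (derive1_of_expansion _ (pconv_recenter (z := z) a1)); first by lra.
move=> h hz; have zh : cabs z + cabs h < 1 by lra.
rewrite gE ?(ps_recenter a1 zh)//.
exact: le_lt_trans (cabsD _ _) zh.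
Qed.

(** Both sides of the differential equation are power series in the disc; compare
coefficients. *)
Lemma solution_coef f A (phi alpha : nat -> R[i]) :
  pconv phi 1 -> pconv alpha 1 ->
  (forall w, cabs w < 1 -> f w = ps phi w) ->
  (forall w, cabs w < 1 -> A w = ps alpha w) ->
  (forall z, unit_disc z -> derive1n 2 f z + A z * f z = 0) ->
  forall n, (n.+1 * n.+2)%:R * phi n.+2 = - cprod alpha phi n.
Proof.
move=> p1 a1 fE AE sol n.
have d1 := pconv_dcoef 1 p1; have d2 := pconv_dcoef 1 d1.
have c1 := pconv_cprod a1 p1.
have m1 : pconv (fun n => -1 * cprod alpha phi n) 1.
  move=> s s0 s1; have [B hB] := c1 s s0 s1; exists B => N.
  by under eq_bigr do rewrite mulN1r cabsN.
have := @ps_unique _ _ _ 1 ltr01 d2 m1 _ n.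
rewrite mulN1r => <-.
  rewrite /dcoef !addn1 !binSn mulrA -natrM //.
move=> z z1; have zD : unit_disc z by apply/unit_discE.
have := sol z zD; rewrite (AE _ z1) (fE _ z1) -(ps_cprod a1 p1 z1).
rewrite -[derive1n 2 f z]/(derive1 (derive1 f) z).
rewrite (derive1_ps d1 (fun w hw => derive1_ps p1 fE hw) z1).
move=> /eqP; rewrite addr_eq0 => /eqP ->.
have [B hB] := pconv_abs c1 z1.
rewrite /ps -[LHS]mulN1r -(csumZ (-1) hB); apply: eq_csum => k; ring.
Qed.

End Equation.

Section WeightedProduct.
Context {R : realType}.
Implicit Types (a c w : nat -> R[i]).

Definition weighted_term a c w j m : R[i] := a j * w (j + m)%N * c m.

Lemma weighted_double a c w (A C : R) : abs_summable a A -> abs_summable c C ->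
  (forall n, cabs (w n) <= 1) ->
  diag_abs_summable (weighted_term a c w) (A * C).
Proof.
move=> aA cC w1 N.
apply: le_trans (triangle_le_rect _ N) _.
apply: (@le_trans _ _ (\sum_(m < N) \sum_(j < N) cabs (a j) * cabs (c m))).
  apply: ler_sum => m _; apply: ler_sum => j _; rewrite /weighted_term !cabsM.
  by rewrite ler_wpM2r ?cabs_ge0// ler_piMr ?cabs_ge0.
under eq_bigr do rewrite -mulr_suml.
rewrite -mulr_sumr ler_pM ?sumr_ge0// => *; exact: cabs_ge0.
Qed.

Definition weighted_coef a w m : R[i] := csum (fun j => a j * w (j + m)%N).

Lemma weighted_summable a w A m : abs_summable a A -> (forall n, cabs (w n) <= 1) ->
  abs_summable (fun j => a j * w (j + m)%N) A.
Proof.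
move=> aA w1; apply: abs_summable_le aA => n.
by rewrite cabsM ler_piMr ?cabs_ge0.
Qed.

Lemma weighted_row a c w A m : abs_summable a A -> (forall n, cabs (w n) <= 1) ->
  csum (weighted_term a c w ^~ m) = weighted_coef a w m * c m.
Proof.
move=> aA w1; rewrite mulrC -(csumZ _ (weighted_summable m aA w1)).
by apply: eq_csum => j; rewrite /weighted_term mulrC.
Qed.

(** With [w n = z^(n+2) / ((n+1)(n+2))] the right-hand side is the double integral
of a product of two power series; the left-hand side expands it in the
coefficients of the second factor.  It is used with [c m = conj(u)^m] for the
kernel and with [c m = phi_m r^m] for the solution. *)
Lemma weighted_coef_series a c w A C : abs_summable a A -> abs_summable c C ->
  (forall n, cabs (w n) <= 1) ->
  csum (fun m => weighted_coef a w m * c m) = csum (fun n => w n * cprod a c n).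
Proof.
move=> aA cC w1.
transitivity (csum (fun m => csum (weighted_term a c w ^~ m))).
  by apply: eq_csum => m; rewrite (weighted_row _ _ aA w1).
rewrite (double_series (weighted_double aA cC w1)); apply: eq_csum => n.
rewrite /diag /cprod mulr_sumr; apply: eq_bigr => j _.
have jn : (j <= n)%N by rewrite -ltnS.
by rewrite /weighted_term subnKC// mulrAC mulrC.
Qed.

Lemma weighted_coef_summable a c w A C : abs_summable a A -> abs_summable c C ->
  (forall n, cabs (w n) <= 1) ->
  abs_summable (fun m => weighted_coef a w m * c m) (A * C).
Proof.
move=> aA cC w1 N.
apply: le_trans (rows_summable (weighted_double aA cC w1) N).
by apply: ler_sum => m _; rewrite (weighted_row _ _ aA w1).
Qed.

Lemma weighted_coef_le a w A m : abs_summable a A -> (forall n, cabs (w n) <= 1) ->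
  cabs (weighted_coef a w m) <= A.
Proof. by move=> aA w1; apply: csum_le; exact: weighted_summable. Qed.

End WeightedProduct.

Section Kernel.
Context {R : realType}.
Implicit Types (A f : R[i] -> R[i]) (alpha phi : nat -> R[i]) (z u w : R[i]) (r : R).

Definition dilate alpha r n : R[i] := alpha n * r%:C ^+ n.

Lemma cabs_rM r z : 0 <= r -> cabs (r%:C * z) = r * cabs z.
Proof. by move=> r0; rewrite cabsM cabs_real ger0_norm. Qed.

Lemma ps_dilate alpha r z : ps (dilate alpha r) z = ps alpha (r%:C * z).
Proof. by apply: eq_csum => n; rewrite /dilate exprMn mulrA. Qed.

Lemma pconv_dilate alpha r : 0 < r -> pconv alpha 1 -> pconv (dilate alpha r) r^-1.
Proof.
move=> r0 a1 s s0 sr; have [|B aB] := a1 (r * s) (mulr_ge0 (ltW r0) s0).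
  by rewrite mulrC -ltr_pdivlMr// div1r.
exists B => N; apply: le_trans (aB N); apply: ler_sum => n _.
by rewrite /dilate cabsM cabsX cabs_real (ger0_norm (ltW r0)) -mulrA -exprMn.
Qed.

Lemma dilate_summable alpha r : 0 < r -> r < 1 -> pconv alpha 1 ->
  exists B, abs_summable (dilate alpha r) B.
Proof.
move=> r0 r1 a1; have [B aB] := a1 r (ltW r0) r1; exists B => N.
apply: le_trans (aB N); apply: ler_sum => n _.
by rewrite /dilate cabsM cabsX cabs_real (ger0_norm (ltW r0)).
Qed.

(** The double integral of [w^n] from 0 to [z]. *)
Definition iweight z n : R[i] := z ^+ n.+2 / (n.+1 * n.+2)%:R.

Lemma iweight_le1 z n : cabs z < 1 -> cabs (iweight z n) <= 1.
Proof.
move=> z1; rewrite /iweight cabsM cabsX cabsV cabs_nat ler_pdivrMr ?ltr0n// mul1r.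
apply: (@le_trans _ _ 1); first by rewrite exprn_ile1 ?cabs_ge0// ltW.
by rewrite ler1n.
Qed.

Lemma ps_icoef2 c z : pconv c 1 -> cabs z < 1 ->
  ps (icoef (icoef c)) z = csum (fun n => iweight z n * c n).
Proof.
move=> c1 z1; have [B hB] := pconv_abs (pconv_icoef (pconv_icoef c1)) z1.
rewrite /ps (csum_recl hB) (csum_recl (abs_summableS hB)) /= !mul0r !add0r.
apply: eq_csum => n; rewrite /iweight natrM invfM.
by set p := (n.+1%:R)^-1; set q := (n.+2%:R)^-1; ring.
Qed.

(** Expand [1 / (1 - conj(u) w)] in powers of [conj(u)] and integrate twice. *)
Lemma A_kernel_ps A alpha r z u : pconv alpha 1 ->
  (forall w, cabs w < 1 -> A w = ps alpha w) -> 0 < r -> r < 1 ->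
  cabs z < 1 -> cabs u < 1 ->
  A_kernel A r z u =
  ps (fun m => (weighted_coef (dilate alpha r) (iweight z) m)^*) u.
Proof.
move=> a1 AE r0 r1 z1 u1; have [B dB] := dilate_summable r0 r1 a1.
have w1 n := iweight_le1 n z1.
have u1' : cabs u^* < 1 by rewrite cabsJ.
pose c m : R[i] := u^* ^+ m.
have cC : abs_summable c (1 - cabs u)^-1.
  move=> N; under eq_bigr do rewrite cabsX cabsJ.
  exact: sum_geometric_le (cabs_ge0 _) u1.
have c1 : pconv c 1.
  apply: (@pconv_of_bounded _ _ _ 1) => n.
  by rewrite expr1n mulr1 cabsX exprn_ile1 ?cabs_ge0// ltW.
have d1 : pconv (dilate alpha r) 1.
  by apply: pconvW (pconv_dilate r0 a1) _; rewrite ltW// invf_gt1.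
have geo w : cabs w < 1 -> ps c w = (1 - u^* * w)^-1.
  move=> w1'; have q1 : cabs (u^* * w) < 1.
    by rewrite cabsM; apply: mulr_ilt1; rewrite ?cabs_ge0.
  apply: csum_eq; apply/cvg_cabsP => e e0.
  have /cvgrPdist_lt /(_ e e0) := geometric_remainder_cvg q1.
  apply: filterS => N; rewrite sub0r normrN => lt.
  rewrite series_ord cabsB (eq_bigr (fun m : 'I_N => (u^* * w) ^+ m)); last first.
    by move=> m _; rewrite /c exprMn.
  apply: le_lt_trans (geometric_remainder N q1) _.
  exact: le_lt_trans (ler_norm _) lt.
have gE w : cabs w < 1 ->
    A (r%:C * w) / (1 - u^* * w) = ps (cprod (dilate alpha r) c) w.
  move=> w1'; rewrite (ps_cprod d1 c1 w1') geo// ps_dilate AE//.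
  by rewrite cabs_rM ?(ltW r0)//; apply: mulr_ilt1; rewrite ?cabs_ge0 ?ltW.
have g1 := pconv_cprod d1 c1.
have segE w : cabs w < 1 -> _ := fun hw => segment_integral_ps g1 hw gE.
rewrite /A_kernel (segment_integral_ps (pconv_icoef g1) z1 segE).
rewrite (ps_icoef2 g1 z1) -(weighted_coef_series dB cC w1).
rewrite -(csum_conj (weighted_coef_summable dB cC w1)).
by apply: eq_csum => m; rewrite /c rmorphM rmorphXn /= conjcK.
Qed.

Lemma pconv_weighted alpha r z : pconv alpha 1 -> 0 < r -> r < 1 -> cabs z < 1 ->
  pconv (weighted_coef (dilate alpha r) (iweight z)) 1.
Proof.
move=> a1 r0 r1 z1; have [B dB] := dilate_summable r0 r1 a1.
apply: (@pconv_of_bounded _ _ _ B) => m; rewrite expr1n mulr1.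
by apply: (weighted_coef_le _ dB) => n; exact: iweight_le1.
Qed.

(** The recurrence for the coefficients of the solution, summed against [(r z)^n]:
the equation integrated twice from 0. *)
Lemma solution_formula alpha phi r z : pconv alpha 1 -> pconv phi 1 ->
  (forall n, (n.+1 * n.+2)%:R * phi n.+2 = - cprod alpha phi n) ->
  0 < r -> r < 1 -> cabs z < 1 ->
  ps (dilate phi r) z = phi 0%N + phi 1%N * (r%:C * z) -
    r%:C ^+ 2 * csum (fun m => weighted_coef (dilate alpha r) (iweight z) m * dilate phi r m).
Proof.
move=> a1 p1 rec r0 r1 z1.
have [A aA] := dilate_summable r0 r1 a1; have [B pB] := dilate_summable r0 r1 p1.
have w1 n := iweight_le1 n z1.
have rz : cabs (r%:C * z) < 1.
  by rewrite cabs_rM ?(ltW r0)//; apply: mulr_ilt1; rewrite ?cabs_ge0 ?ltW.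
have [C hC] := pconv_abs p1 rz.
rewrite ps_dilate /ps (csum_recl hC) (csum_recl (abs_summableS hC)).
rewrite expr0 expr1 mulr1 addrA; congr (_ + _).
rewrite (weighted_coef_series aA pB w1).
have sm : abs_summable (fun n => iweight z n * cprod (dilate alpha r) (dilate phi r) n) (A * B).
  move=> N; apply: le_trans (diag_summable (weighted_double aA pB w1) N).
  apply: ler_sum => n _.
  rewrite /diag /cprod mulr_sumr le_eqVlt; apply/orP; left; apply/eqP; congr cabs.
  apply: eq_bigr => j _; have jn : (j <= n)%N by rewrite -ltnS.
  by rewrite /weighted_term subnKC// [RHS]mulrAC [RHS]mulrC.
rewrite -mulNr -(csumZ _ sm); apply: eq_csum => n.
have cE : cprod (dilate alpha r) (dilate phi r) n = r%:C ^+ n * cprod alpha phi n.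
  rewrite /cprod mulr_sumr; apply: eq_bigr => j _.
  have jn : (j <= n)%N by rewrite -ltnS.
  have -> : r%:C ^+ n = r%:C ^+ j * r%:C ^+ (n - j) :> R[i] by rewrite -exprD subnKC.
  by rewrite /dilate; ring.
have n0 : ((n.+1 * n.+2)%:R : R[i]) != 0 by rewrite pnatr_eq0.
rewrite cE.
have -> : cprod alpha phi n = - ((n.+1 * n.+2)%:R * phi n.+2) by rewrite rec opprK.
have rE : r%:C ^+ n.+2 = r%:C ^+ 2 * r%:C ^+ n :> R[i] by rewrite -exprD.
rewrite /iweight exprMn rE.
move: (r%:C ^+ 2) (r%:C ^+ n) (z ^+ n.+2) (phi n.+2) (n.+1 * n.+2)%:R n0.
by clear => p q s t N N0; field.
Qed.

End Kernel.

(** * The bound *)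

Section Bound.
Context {R : realType}.
Implicit Types (A f : R[i] -> R[i]) (alpha phi b beta : nat -> R[i]) (z w : R[i]).

(** A boundary point is approached along its radius, where the power series is
continuous because it converges beyond the circle. *)
Lemma ps_le_closed_disc b (rho M : R) : 1 < rho -> pconv b rho ->
  (forall z, cabs z < 1 -> cabs (ps b z) <= M) ->
  forall z, cabs z <= 1 -> cabs (ps b z) <= M.
Proof.
move=> rho1 brho bM z z1.
have [K [d [K0 d0 hK]]] := ps_quadratic brho (le_lt_trans z1 rho1).
apply/ler_addgt0Pr => e e0.
set D := ps (dcoef b 1) z in hK.
have D0 := cabs_ge0 D.
have S0 : 0 < K + cabs D + 1 by lra.
have [t [t0 t1 td te]] : exists t : R,
    [/\ 0 < t, t <= 1, t <= d & t * (K + cabs D + 1) <= e].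
  exists (Num.min 1 (Num.min d (e / (K + cabs D + 1)))); split.
  - by rewrite !lt_min ltr01 d0 divr_gt0.
  - by rewrite ge_min lexx.
  - by rewrite !ge_min lexx orbT.
  - by rewrite -ler_pdivlMr// !ge_min lexx !orbT.
pose h : R[i] := (- t)%:C * z.
have ht : cabs h <= t.
  by rewrite cabsM cabs_real normrN gtr0_norm// ler_piMr// ltW.
have zh : cabs (z + h) < 1.
  rewrite (_ : z + h = (1 - t)%:C * z).
    rewrite cabsM cabs_real ger0_norm ?subr_ge0//; nra.
  by rewrite /h rmorphB rmorphN rmorph1; ring.
have := hK h (le_trans ht td).
have h0 := cabs_ge0 h.
have Kh : K * cabs h ^+ 2 <= K * t by rewrite ler_wpM2l//; nra.
have Dh : cabs (D * h) <= cabs D * t by rewrite cabsM ler_wpM2l.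
have := bM _ zh.
set p := ps b (z + h); set q := ps b z => pM pq.
have : cabs q <= cabs p + cabs (p - q - D * h) + cabs (D * h).
  rewrite -[cabs (p - q - _)]cabsN -[cabs (D * h)]cabsN.
  rewrite {1}(_ : q = p + - (p - q - D * h) + - (D * h)); last by ring.
  by apply: le_trans (cabsD _ _) _; rewrite lerD2r cabsD.
have {}te : K * t + cabs D * t + t <= e by rewrite mulrC !mulrDl mul1r in te.
move=> /le_trans; apply; rewrite -addrA; apply: lerD pM _.
apply: le_trans (lerD (le_trans pq Kh) Dh) _.
by apply: le_trans te; rewrite lerDl ltW.
Qed.

(** The truncations of the series are uniformly close to it on the circle, so the
bound for polynomials passes to the limit. *)
Lemma moment_pairing_series (mu : complex_measure R) (v M B S : R) b beta :
  (cmeasure_variation mu <= v%:E)%E -> 0 <= v -> abs_summable b B ->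
  abs_summable (fun m => beta m * b m) S ->
  (forall m, (beta m)^* = moment mu m) ->
  (forall w, cabs w = 1 -> cabs (ps b w) <= M) ->
  cabs (csum (fun m => beta m * b m)) <= v * M.
Proof.
move=> muv v0 bB sS mom bM; rewrite -[csum _]subr0.
apply/ler_addgt0Pr => e e0.
have v1 : 0 < v + 1 by lra.
have [B' [bB' _ /(_ _ (divr_gt0 e0 v1))[N0 tail]]] := abs_summable_sup bB.
apply: (cabs_lim_le (abs_summable_cvg_ord sS)).
exists N0 => // N /= NN; rewrite subr0.
set t := e / (v + 1) in tail.
have -> : \sum_(n < N) beta n * b n = (\sum_(m < N) (b m)^* * moment mu m)^*.
  rewrite rmorph_sum; apply: eq_bigr => m _.
  by rewrite -mom rmorphM /= !conjcK mulrC.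
rewrite cabsJ; apply: (@le_trans _ _ (v * (M + t))).
  apply: moment_pairing_le => // w w1.
  pose y m := b m * w ^+ m.
  have yb m : cabs (y m) <= cabs (b m) by rewrite cabsM cabsX w1 expr1n mulr1.
  have := csum_tail N yb bB'; rewrite -/(ps b w) => h.
  have := cabs_distD (\sum_(m < N) y m) (ps b w) 0; rewrite !subr0.
  rewrite [cabs (_ - ps b w)]cabsB => h2; apply: le_trans h2 _.
  have := bM w w1; have := tail N NN; move: h; clear; lra.
rewrite mulrDr lerD2l /t mulrA ler_pdivrMr// mulrC ler_wpM2l ?(ltW e0)//; lra.
Qed.

(** The equation integrated twice gives [S <= C + v S] for the supremum [S] on the
closed disc; [S] is finite since [r < 1], so it can be moved to the left. *)
Lemma bound_at_radius A (alpha phi : nat -> R[i]) (r v : R) :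
  pconv alpha 1 -> (forall w, cabs w < 1 -> A w = ps alpha w) -> pconv phi 1 ->
  (forall n, (n.+1 * n.+2)%:R * phi n.+2 = - cprod alpha phi n) ->
  0 < r -> r < 1 -> 0 <= v -> v < 1 ->
  (forall z, cabs z < 1 -> exists mu : complex_measure R,
     (cmeasure_variation mu <= v%:E)%E /\
     forall u, unit_disc u -> A_kernel A r z u = cauchy_transform mu u) ->
  forall z, cabs z < 1 ->
  cabs (ps (dilate phi r) z) <= (cabs (phi 0%N) + cabs (phi 1%N)) / (1 - v).
Proof.
move=> a1 AE p1 rec r0 r1 v0 v1 hmu.
have [B pB] := dilate_summable r0 r1 p1; have [A0 aA] := dilate_summable r0 r1 a1.
set C := cabs (phi 0%N) + cabs (phi 1%N).
have step M : (forall w, cabs w = 1 -> cabs (ps (dilate phi r) w) <= M) ->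
    0 <= M -> forall z, cabs z < 1 -> cabs (ps (dilate phi r) z) <= C + v * M.
  move=> hM M0 z z1; have w1 n := iweight_le1 n z1.
  have [mu [muv muE]] := hmu z z1.
  have mom m : (weighted_coef (dilate alpha r) (iweight z) m)^* = moment mu m.
    apply: (@ps_unique _ (fun m => (weighted_coef (dilate alpha r) (iweight z) m)^*)
      (moment mu) 1) => //.
    - exact: pconv_conj (pconv_weighted a1 r0 r1 z1).
    - exact: pconv_moment.
    move=> u u1; rewrite -(A_kernel_ps a1 AE r0 r1 z1 u1) muE; last exact/unit_discE.
    exact: cauchy_transform_ps.
  rewrite (solution_formula a1 p1 rec r0 r1 z1).
  apply: le_trans (cabsD _ _) _; rewrite cabsN; apply: lerD.
    apply: le_trans (cabsD _ _) _; rewrite lerD2l cabsM ler_piMr ?cabs_ge0//.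
    by rewrite cabs_rM ?(ltW r0)// mulr_ile1 ?cabs_ge0// ltW.
  have sS := weighted_coef_summable aA pB w1.
  have h := moment_pairing_series muv v0 pB sS mom hM.
  rewrite cabsM cabsX cabs_real (ger0_norm (ltW r0)); apply: le_trans h.
  by rewrite ler_piMl ?cabs_ge0// exprn_ile1// ltW.
pose S := [set cabs (ps (dilate phi r) z) | z in [set z : R[i] | cabs z <= 1]].
have S0 : S (cabs (ps (dilate phi r) 0)) by exists 0 => //=; rewrite cabs0.
have hS : has_sup S.
  split; first by exists (cabs (ps (dilate phi r) 0)).
  exists B => _ [z /= z1 <-]; apply: csum_le; apply: abs_summable_le pB => n.
  by rewrite cabsM cabsX ler_piMr ?cabs_ge0// exprn_ile1 ?cabs_ge0.
pose M := sup S.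
have leM z : cabs z <= 1 -> cabs (ps (dilate phi r) z) <= M.
  by move=> z1; apply: ub_le_sup; [case: hS|exists z].
have M0 : 0 <= M by apply: le_trans (leM 0 _); rewrite ?cabs_ge0// cabs0.
have r1' : 1 < r^-1 by rewrite invf_gt1.
have MC : M <= C + v * M.
  apply: ge_sup; first by case: hS.
  move=> _ [z /= z1 <-].
  apply: (ps_le_closed_disc r1' (pconv_dilate r0 p1) _ z1).
  by apply: step => // w w1; apply: leM; rewrite w1.
move=> z z1; apply: le_trans (leM z (ltW z1)) _.
rewrite ler_pdivlMr ?subr_gt0//; move: MC; clear; lra.
Qed.

Lemma limf_esup_lt1_left (F : R -> \bar R) : (limf_esup F 1^'- < 1)%E ->
  exists (s : R) (v : R), [/\ s < 1, 0 <= v, v < 1 &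
    forall r, s < r -> r < 1 -> (F r <= v%:E)%E].
Proof.
rewrite /limf_esup => /ereal_inf_lt[_ [V /= FV <-] VF].
have [e /= e0 hV] : exists2 e : R, 0 < e & forall r, 1 - e < r -> r < 1 -> V r.
  have /nbhs_ballP[e /= e0 he] : nbhs (1 : R) [set x | x < 1 -> V x] by [].
  exists e => // r re r1; apply: he => //.
  by rewrite -ball_normE /= ltr_norml; apply/andP; split; lra.
exists (1 - e); have hle r : 1 - e < r -> r < 1 -> (F r <= ereal_sup (F @` V))%E.
  by move=> re r1; apply: ereal_sup_ubound; exists r => //; exact: hV.
case: (ereal_sup (F @` V)) VF hle => [x| |]//.
- rewrite lte_fin => x1 hle; exists (Num.max 0 x); split.
  + by lra.
  + by rewrite le_max lexx.
  + by rewrite gt_max ltr01.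
  + move=> r re r1; apply: le_trans (hle r re r1) _.
    by rewrite lee_fin le_max lexx orbT.
- move=> _ hle; exists 0; split => //; first by lra.
  by move=> r re r1; apply: le_trans (hle r re r1) _; exact: leNye.
Qed.

End Bound.

Theorem theorem2 (R : realType) (A : R[i] -> R[i])
    (A_analytic : analytic_on (@unit_disc R) A)
    (limsup_lt1 :
      (limf_esup
         (fun r : R => ereal_sup
            [set cauchy_norm (A_kernel A r z) | z in @unit_disc R])
         1^'- < 1)%E)
    (f : R[i] -> R[i])
    (f_analytic : analytic_on (@unit_disc R) f)
    (f_solution : forall z, unit_disc z -> derive1n 2 f z + A z * f z = 0) :
  exists M : R, forall z, unit_disc z -> `|f z| <= M%:C.
Proof.
have [alpha [a1 AE]] := analytic_power_series A_analytic.
have [phi [p1 fE]] := analytic_power_series f_analytic.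
have rec := solution_coef p1 a1 fE AE f_solution.
have [s [v [s1 v0 v1 hv]]] := limf_esup_lt1_left limsup_lt1.
(* The norm is an infimum over measures, possibly not attained: [v'] leaves room for
   an actual measure. *)
pose v' := (v + 1) / 2.
have vv' : v < v' by rewrite /v'; lra.
have v'0 : 0 <= v' by rewrite /v'; lra.
have v'1 : v' < 1 by rewrite /v'; lra.
exists ((cabs (phi 0%N) + cabs (phi 1%N)) / (1 - v')) => w /unit_discE w1.
rewrite leC_cabs.
pose m := Num.max s (cabs w); have m1 : m < 1 by rewrite gt_max s1.
pose r := (m + 1) / 2.
have mr : m < r by rewrite /r; lra.
have r1 : r < 1 by rewrite /r; lra.
move: (mr); rewrite gt_max => /andP[sr wr].
have r0 : 0 < r by apply: le_lt_trans wr; exact: cabs_ge0.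
have hmu z : cabs z < 1 -> exists mu : complex_measure R,
     (cmeasure_variation mu <= v'%:E)%E /\
     forall u, unit_disc u -> A_kernel A r z u = cauchy_transform mu u.
  move=> z1; have : (cauchy_norm (A_kernel A r z) < v'%:E)%E.
    apply: (@le_lt_trans _ _ v%:E); last by rewrite lte_fin.
    apply: le_trans (hv r sr r1); apply: ereal_sup_ubound.
    by exists z => //; exact/unit_discE.
  by move=> /ereal_inf_lt[_ [mu /= muE <-] /ltW muv]; exists mu.
have rN0 : r%:C != 0 :> R[i] by rewrite -cabs_gt0 cabs_real gtr0_norm.
have := bound_at_radius a1 AE p1 rec r0 r1 v'0 v'1 hmu (z := w / r%:C).
rewrite ps_dilate [r%:C * _]mulrC divfK// fE//; apply.
by rewrite cabsM cabsV cabs_real gtr0_norm// ltr_pdivrMr// mul1r.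
Qed.
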